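(* Let $\ell\geq1$ be an integer and, for $j=1,2$, let $a^j\in C^{2+\ell}(\mathbb{R}\times\mathbb{R}^n;\mathbb{R}^{n\times n})$ be symmetric and elliptic (as defined in the context) and of the form $$a^j(\mu,\eta)=\gamma^j(\mu,\eta)\,\mathrm{Id}_{\mathbb{R}^{n\times n}},\quad(\mu,\eta)\in\mathbb{R}\times\mathbb{R}^n,\qquad \gamma^j\in C^{2+\ell}(\mathbb{R}\times\mathbb{R}^n;(0,+\infty)).$$ Assume that there exist an orthonormal basis $\{e_1',\ldots,e_n'\}$ of $\mathbb{R}^n$ and points $x_1,\ldots,x_n\in\partial\Omega$ such that $|\nu(x_k)-e_k'|<\frac1{\sqrt n}$ for $k=1,\ldots,n$. Fix $R>0$ and, for $j=1,2$, $\lambda\in[-R,R]$, $\omega\in\mathbb{S}^{n-1}$ and $\tau\in(-\epsilon_\lambda,\epsilon_\lambda)$, let $u^j_{\lambda,\omega,\tau}\in C^{2+\alpha}(\overline\Omega)$ be the unique solution of $$-\sum_{i,k=1}^n\partial_{x_i}\big(a^j_{i,k}(u,\nabla u)\,\partial_{x_k}u\big)=0\ \text{ in }\Omega,\qquad u(x)=\lambda+\tau\,x\cdot\omega\ \text{ for }x\in\partial\Omega .$$ Let $x_0\in\partial\Omega$ be arbitrary and, for each $\lambda\in[-R,R]$, let $\epsilon=\epsilon(\lambda)$ be an arbitrary number in $(0,\epsilon_\lambda)$. If $$\partial_{\nu_{a^1}}u^1_{\lambda,\omega,\tau}(x_0)=\partial_{\nu_{a^2}}u^2_{\lambda,\omega,\tau}(x_0)\qquad\text{for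 all }\lambda\in[-R,R],\ \omega\in\mathbb{S}^{n-1},\ \tau\in(-\epsilon,\epsilon),$$ then $$D_\eta^k a^1(\lambda,0)=D_\eta^k a^2(\lambda,0)\qquad\text{for all }\lambda\in[-R,R],\ k=0,\ldots,\ell-1 .$$
   Context: Let $n\geq2$, $\alpha\in(0,1)$, and let $\Omega\subset\mathbb{R}^n$ be a bounded domain with $C^{2+\alpha}$ boundary; $\nu$ is the outward unit normal to $\partial\Omega$ and $\mathbb{S}^{n-1}=\{x\in\mathbb{R}^n:|x|=1\}$. Variables of a coefficient $a$ are written $(\mu,\eta)\in\mathbb{R}\times\mathbb{R}^n$. A coefficient $a=(a_{i,k})$ is symmetric if $a_{i,k}(\mu,\eta)=a_{k,i}(\mu,\eta)$ for all $(\mu,\eta)$ and $i,k$; it is elliptic if there is $\kappa\in C(\mathbb{R}\times\mathbb{R}^n;(0,+\infty))$ with $\sum_{i,k=1}^n a_{i,k}(\mu,\eta)\xi_i\xi_k\geq\kappa(\mu,\eta)|\xi|^2$ for all $\mu\in\mathbb{R}$, $\eta,\xi\in\mathbb{R}^n$. For each $\lambda\in\mathbb{R}$, $\epsilon_\lambda>0$ denotes a number, depending only on $a^1,a^2,\lambda,\Omega$, such that for $j=1,2$, all $\omega\in\mathbb{S}^{n-1}$ and all $\tau\in(-\epsilon_\lambda,\epsilon_\lambda)$ the boundary value problem in the claim has a unique solution $u^j_{\lambda,\omega,\tau}\in C^{2+\alpha}(\overline\Omega)$, and such that $\tau\mapsto u^j_{\lambda,\omega,\tau}$ belongs to $C^\ell((-\epsilon_\lambda,\epsilon_\lambda);C^{2+\alpha}(\overline\Omega))$.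 The flux is $\partial_{\nu_{a^j}}u(x)=\sum_{i,k=1}^n a^j_{i,k}(u(x),\nabla u(x))\,\partial_{x_k}u(x)\,\nu_i(x)$, $x\in\partial\Omega$. $D_\eta^k a(\lambda,0)$ denotes the $k$-th order derivative of $a$ with respect to $\eta$ at $(\lambda,0)$ (with $D^0_\eta a=a$). *)

(* Defs.v *)
From HB Require Import structures.
From mathcomp Require Import all_boot all_order all_algebra.
From mathcomp Require Import all_classical all_reals all_analysis.
Import Order.TTheory GRing.Theory Num.Theory numFieldNormedType.Exports.

Set Implicit Arguments.
Unset Strict Implicit.
Unset Printing Implicit Defensive.

Local Open Scope classical_set_scope.
Local Open Scope ring_scope.

(* Vectors of R^n are row vectors. The norm `|_| that the library puts on
   'rV[R]_n is the sup norm (it only matters here for the topology), so the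
   Euclidean structure is defined separately. *)
Section Euclidean.
Context {R : realType} {n : nat}.
Implicit Types x y : 'rV[R]_n.

Definition dot x y : R := \sum_(i < n) x 0 i * y 0 i.

Definition enorm x : R := Num.sqrt (dot x x).

Definition orthonormal_basis (e : 'I_n -> 'rV[R]_n) : Prop :=
  forall i k, dot (e i) (e k) = (i == k)%:R.

End Euclidean.

Section Derivatives.
Context {R : realType} {V W : normedModType R}.

(* Maps of class C^k on the whole space, for V finite dimensional (where the
   continuity of all the x |-> D_v f x is that of the differential). *)
Fixpoint Ck (k : nat) (f : V -> W) : Prop :=
  if k is k'.+1 then
    (forall x, differentiable f x) /\ (forall v, Ck k' (fun x => 'D_v f x))
  else continuous f.

(* The k-th derivative at x, as the k-linear map
   (v_1, ..., v_k) |-> D_{v_1} ... D_{v_k} f (x). *)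
Definition Dk (k : nat) (f : V -> W) (x : V) : k.-tuple V -> W :=
  fun vs => foldr (fun v (g : V -> W) => fun y => 'D_v g y) f vs x.

End Derivatives.

Section Holder.
Context {R : realType} {n : nat}.
Implicit Types (D : set 'rV[R]_n) (f g u : 'rV[R]_n -> R) (x : 'rV[R]_n).

Definition partial (i : 'I_n) f : 'rV[R]_n -> R :=
  fun x => 'D_(delta_mx 0 i) f x.

Definition partials (s : seq 'I_n) f : 'rV[R]_n -> R := foldr partial f s.

Definition gradient f x : 'rV[R]_n := \row_i partial i f x.

(* Functions of C^k of the closure of D, for D open, are represented by total
   functions whose values outside the closure are irrelevant: the derivatives
   are taken in D, and extend continuously to the closure. *)
Definition Ck_closure D (k : nat) f : Prop :=
  [/\ {within closure D, continuous f},
      forall (s : seq 'I_n) (i : 'I_n) x, (size s < k)%N -> D x ->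
        derivable (partials s f) x (delta_mx 0 i)
    & forall s : seq 'I_n, (size s <= k)%N ->
        exists2 g, {within closure D, continuous g}
                 & forall x, D x -> g x = partials s f x].

Definition holder_norm D (k : nat) (alpha : R) f : \bar R :=
  (\sum_(m < k.+1) \sum_(s : m.-tuple 'I_n)
      ereal_sup [set `|partials s f x|%:E | x in D]
   + \sum_(s : k.-tuple 'I_n)
      ereal_sup [set (`|partials s f p.1 - partials s f p.2|
                       / enorm (p.1 - p.2) `^ alpha)%:E
                | p in [set p : 'rV[R]_n * 'rV[R]_n |
                         [/\ D p.1, D p.2 & p.1 != p.2]]])%E.

(* The space C^{k + alpha} of the closure of D. *)
Definition holder_space D (k : nat) (alpha : R) f : Prop :=
  Ck_closure D k f /\ (holder_norm D k alpha f < +oo)%E.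

(* Curves of class C^l on ]-e, e[ with values in the Banach space
   C^{k + alpha} of the closure of D; [du] is the derivative of [u]. *)
Fixpoint holder_curve_C (l : nat) D (k : nat) (alpha e : R)
    (u : R -> 'rV[R]_n -> R) : Prop :=
  (forall t, - e < t < e -> holder_space D k alpha (u t)) /\
  if l is l'.+1 then
    exists2 du : R -> 'rV[R]_n -> R,
      holder_curve_C l' D k alpha e du &
      forall t, - e < t < e ->
        holder_norm D k alpha
          (fun x => h^-1 * (u (t + h) x - u t x) - du t x) @[h --> 0^'] --> 0%E
  else
    forall t, - e < t < e ->
      holder_norm D k alpha (fun x => u s x - u t x) @[s --> t] --> 0%E.

(* The continuous extension to the closure of D of a function on D. *)
Definition clext D g x : R := lim (g y @[y --> within D (nbhs x)]).

Definition clgradient D u x : 'rV[R]_n := \row_i clext D (partial i u) x.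

End Holder.

Section Domains.
Context {R : realType} {n : nat}.
Implicit Types (Omega : set 'rV[R]_n) (x : 'rV[R]_n).

Definition boundary Omega : set 'rV[R]_n := closure Omega `\` interior Omega.

Definition bounded_domain Omega : Prop :=
  [/\ Omega !=set0, open Omega, connected Omega & bounded_set Omega].

(* Near every boundary point, a C^{k + alpha} diffeomorphism [psi] : U -> V
   with inverse [phi] straightens the boundary; the half-space is
   {z_i > 0}, for some coordinate i. *)
Definition holder_boundary (k : nat) (alpha : R) Omega : Prop :=
  forall x, boundary Omega x ->
  exists (U V : set 'rV[R]_n) (psi phi : 'rV[R]_n -> 'rV[R]_n) (i : 'I_n),
    [/\ [/\ open U, U x & open V],
        (forall y, U y -> V (psi y) /\ phi (psi y) = y) /\
        (forall z, V z -> U (phi z) /\ psi (phi z) = z),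
        forall m : 'I_n, holder_space U k alpha (fun y => psi y 0 m) /\
                         holder_space V k alpha (fun z => phi z 0 m)
      & forall y, U y -> (Omega y <-> 0 < psi y 0 i) /\
                         (boundary Omega y <-> psi y 0 i = 0)].

(* [v] is a unit vector, orthogonal to the velocities at x of the curves drawn
   on the boundary, and pointing out of the domain. *)
Definition outward_unit_normal Omega x (v : 'rV[R]_n) : Prop :=
  [/\ enorm v = 1,
      forall c : R -> 'rV[R]_n, derivable c 0 1 -> c 0 = x ->
        (\forall t \near 0, boundary Omega (c t)) -> dot v ('D_1 c 0) = 0
    & \forall t \near 0^'+, ~ closure Omega (x + t *: v)].

End Domains.

Section Problem.
Context {R : realType} {n : nat}.
Implicit Types (a : R -> 'rV[R]_n -> 'M[R]_n) (Omega : set 'rV[R]_n).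
Implicit Types (f u : 'rV[R]_n -> R).

Definition symmetric_coef a : Prop :=
  forall mu eta i k, a mu eta i k = a mu eta k i.

Definition elliptic_coef a : Prop :=
  exists kappa : R -> 'rV[R]_n -> R,
    [/\ continuous (fun p : R * 'rV[R]_n => kappa p.1 p.2),
        forall mu eta, 0 < kappa mu eta
      & forall mu eta (xi : 'rV[R]_n),
          kappa mu eta * enorm xi ^+ 2
          <= \sum_(i < n) \sum_(k < n) a mu eta i k * xi 0 i * xi 0 k].

Definition is_solution (alpha : R) Omega a f u : Prop :=
  [/\ holder_space Omega 2 alpha u,
      forall x, Omega x ->
        - (\sum_(i < n) \sum_(k < n)
             partial i (fun y => a (u y) (gradient u y) i k * partial k u y) x)
        = 0
    & forall x, boundary Omega x -> u x = f x].

Definition is_unique_solution (alpha : R) Omega a f u : Prop :=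
  is_solution alpha Omega a f u /\
  forall v, is_solution alpha Omega a f v ->
    forall x, closure Omega x -> v x = u x.

Definition dirichlet_data (lambda : R) (omega : 'rV[R]_n) (tau : R) :
  'rV[R]_n -> R := fun x => lambda + tau * dot x omega.

(* What is required of epsilon_lambda, uniformly in j and omega: unique
   solvability for |tau| < e, and C^l dependence of the solution on tau. *)
Definition admissible_radius (l : nat) (alpha : R) Omega
    (a : 'I_2 -> R -> 'rV[R]_n -> 'M[R]_n) (lambda e : R) : Prop :=
  0 < e /\
  forall (j : 'I_2) (omega : 'rV[R]_n), enorm omega = 1 ->
    exists u : R -> 'rV[R]_n -> R,
      (forall tau, - e < tau < e ->
         is_unique_solution alpha Omega (a j)
           (dirichlet_data lambda omega tau) (u tau)) /\
      holder_curve_C l Omega 2 alpha e u.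

Definition conormal_flux Omega (nu : 'rV[R]_n -> 'rV[R]_n) a u
    (x : 'rV[R]_n) : R :=
  let grad := clgradient Omega u x in
  \sum_(i < n) \sum_(k < n) a (u x) grad i k * grad 0 k * nu x 0 i.

End Problem.

(* Main.v *)
(* Fix [lambda]. Expanded in nondivergence form, the equation has second order
   terms [gamma(u, grad u) Delta u] plus terms at least quadratic in
   [(grad u, D^2 u)], so near the constant solution [lambda] it is a perturbation
   of the Laplace equation, and [u_tau = lambda + tau x.omega + o(tau)] in C^2.
   Suppose that all [eta]-derivatives of order < m of [gamma^1] and [gamma^2] agree
   at [(mu, 0)] for [mu] near [lambda]. By Taylor's formula in [eta] the two
   operators then differ by [o(tau^(m+1))] along [u^2], so that the first
   nonvanishing [tau]-derivative of order at most m+1 of [u^1 - u^2] at 0 would be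
   harmonic with zero boundary values: hence [u^1 - u^2 = o(tau^(m+1))].
   The term of order m+1 of the flux equality at [x_0] is
   [D_omega^m (gamma^1 - gamma^2)(lambda, 0) * (omega . nu(x_0)) = 0]. The second
   factor is nonzero for an open set of [omega], so polarization yields the full
   derivative of order m. Induction on m gives the interior of [[-R, R]], and
   continuity its end points. *)

Require Import Defs.
From HB Require Import structures.
From mathcomp Require Import all_boot all_order all_algebra.
From mathcomp Require Import all_classical all_reals all_analysis.
From mathcomp Require Import ring lra.
Import Order.TTheory GRing.Theory Num.Theory numFieldNormedType.Exports.

Set Implicit Arguments.
Unset Strict Implicit.
Unset Printing Implicit Defensive.

Local Open Scope classical_set_scope.
Local Open Scope ring_scope.

(** * Taylor expansions *)

(** Expanding the divergence brings in first derivatives of [gamma^1 - gamma^2] in both variables,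
    and this loss shapes the proof. The [eta]-derivatives drop to O(t^(m-1)) for m >= 1; this is
    repaired by their factors grad u = O(t) and D^2 u, which is o(t) and not merely O(t). Hence the
    first-order expansion in C^2 has to precede every comparison. The [mu]-derivatives stay O(t^m)
    only when flatness holds for all [mu] near lambda, which is why the induction treats an open
    interval of lambda at once. All limits are taken at a fixed point x as t decreases to 0. The
    Banach-valued curve enters only through the real functions of t given by the partial derivatives
    of order at most 2 at x, extended to the closure. No remainder uniform in x is needed, because
    the maximum principle is applied to t-derivatives at t = 0, which are C^2 functions themselves.
    Step m reads off the coefficient of t^(m+1), so it needs m+1 <= l derivatives of the curve: the
    orders therefore stop at l-1. *)

Section Taylor.
Context {R : realType}.
Implicit Types (g : nat -> R -> R) (s t c e : R).

(** Lagrange remainder without iterated derivatives: the successive derivatives are handed over as a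
    sequence [g], and the bound on the last one is integrated [m] times, each time by the mean value
    theorem for the difference with the bounding monomial. *)
Lemma taylor_ge m g s c :
  (forall k t, (k < m)%N -> 0 <= t <= s -> is_derive t 1 (g k) (g k.+1 t)) ->
  (forall k, (k < m)%N -> g k 0 = 0) ->
  (forall t, 0 <= t <= s -> c <= g m t) ->
  forall t, 0 <= t <= s -> c * (t ^+ m / m`!%:R) <= g 0%N t.
Proof.
elim: m g => [g _ _ gc t ts|m IHm g dg g0 gc t /andP[t0 ts]].
  by rewrite expr0 fact0 divr1 mulr1 gc.
have g1 r : 0 <= r <= s -> c * (r ^+ m / m`!%:R) <= g 1%N r.
  by apply: (IHm (fun k => g k.+1)) => [k r'||] *; [exact: dg|exact: g0|exact: gc].
pose h r := g 0%N r - c * (r ^+ m.+1 / m.+1`!%:R).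
have dh r : 0 <= r <= s -> is_derive r 1 h (g 1%N r - c * (r ^+ m / m`!%:R)).
  move=> rs; have := dg 0%N r isT rs => ?.
  have -> : h = g 0%N - (c / m.+1`!%:R) *: (id ^+ m.+1).
    apply/funext => z; rewrite /h /= -![(_ - _ : _ -> _) _]/(_ - _).
    rewrite -[(_ *: _ : _ -> _) _]/(_ *: (_ _)) /GRing.scale /=.
    by rewrite fctE /=; lra.
  apply: is_derive_eq; rewrite /GRing.scale /= factS natrM.
  have m0 : m.+1%:R != 0 :> R by rewrite pnatr_eq0.
  have f0 : m`!%:R != 0 :> R by rewrite pnatr_eq0 -lt0n fact_gt0.
  by move: (m.+1%:R) m0 (m`!%:R) f0 => p p0 q q0; field; rewrite p0 q0.
have h0 : h 0 = 0 by rewrite /h g0// exprS !mul0r mulr0 subr0.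
suff : h 0 <= h t by rewrite h0 subr_ge0.
have [] := @MVT_segment R h (fun r => g 1%N r - c * (r ^+ m / m`!%:R)) 0 t t0.
- move=> r; rewrite in_itv /= => /andP[r0 rt]; apply: dh.
  by rewrite ltW//= (le_trans (ltW rt)).
- apply: derivable_within_continuous => r; rewrite in_itv /= => /andP[r0 rt].
  have rs : 0 <= r <= s by rewrite r0 (le_trans rt).
  by have := dh r rs.
move=> r; rewrite in_itv /= => /andP[r0 rt] E.
rewrite -subr_ge0 E subr0 mulr_ge0// subr_ge0 g1// r0 (le_trans rt)//.
Qed.

Lemma taylor_le m g s c :
  (forall k t, (k < m)%N -> 0 <= t <= s -> is_derive t 1 (g k) (g k.+1 t)) ->
  (forall k, (k < m)%N -> g k 0 = 0) ->
  (forall t, 0 <= t <= s -> g m t <= c) ->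
  forall t, 0 <= t <= s -> g 0%N t <= c * (t ^+ m / m`!%:R).
Proof.
move=> dg g0 gc t ts; rewrite -lerN2 -mulNr.
apply: (@taylor_ge m (fun k r => - g k r) s) => // [k r km rs|k km|r rs].
- by have := dg k r km rs; exact: is_deriveN.
- by rewrite g0// oppr0.
- by rewrite lerN2 gc.
Qed.

(** The last function is only assumed continuous at 0, like the top derivative of a C^l curve. That
    traps [g m] between two constants on [0, t], and both integrated bounds apply; the margin is d
    times m! so that the factorial of the Taylor coefficient cancels. *)
Lemma taylor_cvg m g e : 0 < e ->
  (forall k t, (k < m)%N -> - e < t < e -> is_derive t 1 (g k) (g k.+1 t)) ->
  (forall k, (k < m)%N -> g k 0 = 0) ->
  {for 0, continuous (g m)} ->
  (t ^- m * g 0%N t) @[t --> 0^'+] --> g m 0 / m`!%:R.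
Proof.
move=> e0 dg g0 cg; apply/cvgrPdist_le => d d0.
have f0 : 0 < m`!%:R :> R by rewrite ltr0n fact_gt0.
have fd0 : 0 < d * m`!%:R by rewrite mulr_gt0.
move/cvgrPdist_le : cg => /(_ _ fd0) /nbhs_ballP[r /= r0 rg].
near=> t.
have t0 : 0 < t by [].
have te : t < e by near: t; exact: nbhs_right_lt.
have tr : t < r by near: t; exact: nbhs_right_lt.
have dgt k z : (k < m)%N -> 0 <= z <= t -> is_derive z 1 (g k) (g k.+1 z).
  move=> km /andP[z0 zt]; apply: dg => //; rewrite (le_lt_trans zt te) andbT.
  by rewrite (lt_le_trans _ z0)// oppr_lt0.
have gz z : 0 <= z <= t -> g m 0 - d * m`!%:R <= g m z <= g m 0 + d * m`!%:R.
  move=> /andP[z0 zt]; rewrite -ler_distlC; apply: rg.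
  by rewrite /ball /= sub0r normrN ger0_norm// (le_lt_trans zt).
have tt : 0 <= t <= t by rewrite ltW/=.
have gel := taylor_ge dgt g0 (fun z zt => proj1 (andP (gz z zt))) tt.
have gle := taylor_le dgt g0 (fun z zt => proj2 (andP (gz z zt))) tt.
have tm : 0 < t ^+ m by rewrite exprn_gt0.
rewrite ler_distlC; apply/andP; split.
- rewrite ler_pdivlMl//; apply: le_trans gel; rewrite le_eqVlt; apply/orP; left.
  by apply/eqP; field; rewrite gt_eqF.
- rewrite ler_pdivrMl//; apply: (le_trans gle); rewrite le_eqVlt; apply/orP; left.
  by apply/eqP; field; rewrite gt_eqF.
Unshelve. all: by end_near. Qed.

End Taylor.

Lemma is_deriveP (R : realType) (V W : normedModType R) (f : V -> W) (x v : V) (d : W) :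
  is_derive x v f d <-> h^-1 *: (f (h *: v + x) - f x) @[h --> 0^'] --> d.
Proof.
split=> [[df <-]|fd]; first exact: df.
by split; [apply/cvg_ex; exists d|exact: cvg_lim fd].
Qed.

Lemma ler_dist_half (R : realType) (p q z e : R) :
  `|p - z| <= e / 2 -> `|q - z| <= e / 2 -> `|q - p| <= e.
Proof.
by move=> pz qz; rewrite (splitr e) (le_trans (ler_distD z _ _))// lerD// distrC.
Qed.

(** * Iterated directional derivatives *)

Section DirectionalDerivatives.
Context {R : realType} {V : normedModType R}.
Implicit Types (f g : V -> R) (v w x : V) (k m : nat).

Lemma is_derive_line f x v (s : R) : derivable f (x + s *: v) v ->
  is_derive s 1 (fun t : R => f (x + t *: v)) ('D_v f (x + s *: v)).
Proof.
move=> /derivableP /is_deriveP df; apply/is_deriveP.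
apply: cvg_trans df; apply: near_eq_cvg; near=> h.
by rewrite [h *: 1]mulr1 scalerDl addrCA.
Unshelve. all: by end_near. Qed.

Lemma deriveDdir f x v w (c : R) : differentiable f x ->
  'D_(v + c *: w) f x = 'D_v f x + c * 'D_w f x.
Proof. by move=> df; rewrite !deriveE// linearD linearZ. Qed.

Lemma deriveZdir f x v (c : R) : differentiable f x ->
  'D_(c *: v) f x = c * 'D_v f x.
Proof. by move=> df; rewrite !deriveE// linearZ. Qed.

Lemma is_derive_lin f g x v (c df dg : R) : is_derive x v f df -> is_derive x v g dg ->
  is_derive x v (fun y => f y + c * g y) (df + c * dg).
Proof. by move=> fd gd; exact: (is_deriveD fd (is_deriveZ c gd)). Qed.

Lemma derive_lin f g x v (c : R) : derivable f x v -> derivable g x v ->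
  'D_v (fun y => f y + c * g y) x = 'D_v f x + c * 'D_v g x.
Proof.
by move=> /derivableP fd /derivableP gd; have [_ ->] := is_derive_lin c fd gd.
Qed.

Lemma CkS k f : Ck k.+1 f -> Ck k f.
Proof.
elim: k f => [f [df _] x|k IHk f [df dDf]]; first exact: differentiable_continuous.
by split=> // v; apply: IHk.
Qed.

Lemma CkW k m f : (m <= k)%N -> Ck k f -> Ck m f.
Proof.
move=> /subnK <-; elim: (k - m)%N => // d IHd; rewrite addSn => /CkS; exact: IHd.
Qed.

Lemma Ck_continuous k f : Ck k f -> continuous f.
Proof. exact: (@CkW k 0). Qed.

Lemma Ck_lin k f g (c : R) : Ck k f -> Ck k g -> Ck k (fun x => f x + c * g x).
Proof.
elim: k f g => [f g cf cg x|k IHk f g [df Df] [dg Dg]].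
  apply: cvgD; first exact: cf.
  by apply: cvgM; [exact: cvg_cst|exact: cg].
have E : (fun x => f x + c * g x) = f + c *: g by [].
split=> [x|v]; first by rewrite E; apply: differentiableD => //; exact: differentiableZ.
suff -> : 'D_v (fun x => f x + c * g x) = fun x => 'D_v f x + c * 'D_v g x.
  by apply: IHk; [exact: Df|exact: Dg].
by apply/funext => x; apply: derive_lin; exact: diff_derivable.
Qed.

Lemma Ck_cst k (c : R) : Ck k (fun _ : V => c).
Proof.
elim: k c => [|k IHk] c; first exact: cst_continuous.
split=> [x|v]; first exact: differentiable_cst.
suff -> : 'D_v (fun=> c) = fun=> 0 by exact: IHk.
by apply/funext => x; rewrite derive_cst.
Qed.

Lemma Ck_sum (I : Type) (r : seq I) k (c : I -> R) (F : I -> V -> R) :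
  (forall i, Ck k (F i)) -> Ck k (fun x => \sum_(i <- r) c i * F i x).
Proof.
move=> CF; elim: r => [|i r IHr].
  by under eq_fun do rewrite big_nil; exact: Ck_cst.
by under eq_fun do rewrite big_cons addrC; exact: Ck_lin.
Qed.

Definition iderive m v f := iter m (fun g : V -> R => fun x => 'D_v g x) f.

Lemma iderivSr m v f : iderive m.+1 v f = iderive m v ('D_v f).
Proof. exact: iterSr. Qed.

Lemma iderive_Ck m k v f : Ck (m + k) f -> Ck k (iderive m v f).
Proof. elim: m k => // m IHm k Cf.
have [_] : Ck k.+1 (iderive m v f) by apply: IHm; rewrite addnS.
exact. Qed.

Lemma iderive_lin m v f g (c : R) : Ck m f -> Ck m g ->
  iderive m v (fun x => f x + c * g x) =
  (fun x => iderive m v f x + c * iderive m v g x).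
Proof.
elim: m => // m IHm Cf Cg; rewrite /= IHm; [|exact: CkS|exact: CkS].
have [df _] : Ck 1 (iderive m v f) by apply: iderive_Ck; rewrite addn1.
have [dg _] : Ck 1 (iderive m v g) by apply: iderive_Ck; rewrite addn1.
apply/funext => x.
by apply: derive_lin; exact: diff_derivable.
Qed.

Lemma iderive_cst m v (c : R) : (0 < m)%N -> iderive m v (fun=> c) = fun=> 0.
Proof.
case: m => // m _; elim: m => [|m /= ->]; apply/funext => x; exact: derive_cst.
Qed.

Lemma iderive_sum (I : Type) (r : seq I) m v (c : I -> R) (F : I -> V -> R) :
  (forall i, Ck m (F i)) ->
  iderive m v (fun x => \sum_(i <- r) c i * F i x) =
  (fun x => \sum_(i <- r) c i * iderive m v (F i) x).
Proof.
move=> CF; elim: r => [|i r IHr].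
  rewrite (_ : (fun x => \sum_(i <- [::]) c i * F i x) = fun=> 0); last first.
    by apply/funext => x; rewrite big_nil.
  apply/funext => x; rewrite big_nil; case: m {CF} => // m.
  by rewrite iderive_cst.
rewrite (_ : (fun x => \sum_(i <- i :: r) c i * F i x) =
    fun x => \sum_(i <- r) c i * F i x + c i * F i x); last first.
  by apply/funext => x; rewrite big_cons addrC.
rewrite iderive_lin//; last exact: Ck_sum.
by apply/funext => x; rewrite IHr big_cons addrC.
Qed.

Lemma mean_value f x v (h : R) : (forall y, differentiable f y) -> 0 <= h ->
  exists2 s, 0 <= s <= h & f (x + h *: v) - f x = h * 'D_v f (x + s *: v).
Proof.
move=> df h0.
have dl (s : R) : is_derive s 1 (fun t : R => f (x + t *: v)) ('D_v f (x + s *: v)).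
  by apply: is_derive_line; exact: diff_derivable.
have [|s sh] := @MVT_segment R _ _ 0 h h0 (fun s _ => dl s).
  by apply: derivable_within_continuous => s _; have := dl s.
by rewrite scale0r addr0 subr0 mulrC => E; exists s.
Qed.

Lemma derive_translate f v x y : 'D_v (fun z => f (z + y)) x = 'D_v f (x + y).
Proof.
rewrite /derive.
suff -> : (fun h => h^-1 *: (((fun z => f (z + y)) \o shift x) (h *: v) - f (x + y))) =
    (fun h => h^-1 *: ((f \o shift (x + y)) (h *: v) - f (x + y))) by [].
by apply/funext => h /=; rewrite addrA.
Qed.

(** Schwarz's theorem. The second difference of [f] over the parallelogram spanned by h v and h w is
    symmetric in [v] and [w], and two mean value theorems turn it into h^2 times either mixed
    derivative at some point of the parallelogram; continuity of both at [x] concludes. *)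
Lemma derive_comm f v w x : Ck 2 f -> 'D_v ('D_w f) x = 'D_w ('D_v f) x.
Proof.
move=> [df Df].
have [dv Dv] := Df v; have [dw Dw] := Df w.
pose G := 'D_w ('D_v f); pose H := 'D_v ('D_w f).
have cG : continuous G by exact: Dv.
have cH : continuous H by exact: Dw.
have key v' w' h : (forall y, differentiable ('D_v' f) y) -> 0 < h ->
   exists s t, [/\ 0 <= s <= h, 0 <= t <= h &
   f (x + h *: v' + h *: w') - f (x + h *: v') - f (x + h *: w') + f x =
   h * h * 'D_w' ('D_v' f) (x + s *: v' + t *: w')].
  move=> dv' h0.
  pose p (y : V) := f (y + h *: w') + (-1) * f y.
  have dfs y : differentiable (fun y => f (y + h *: w')) y.
    apply: (@differentiable_comp _ _ _ _ (fun y => y + h *: w') f) => //.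
  have pE : p = (fun y => f (y + h *: w')) + (-1) *: f by [].
  have dp y : differentiable p y.
    by rewrite pE; apply: differentiableD => //; exact: differentiableZ.
  have [s sh Es] := mean_value x v' dp (ltW h0).
  have [t th Et] := mean_value (x + s *: v') w' dv' (ltW h0).
  exists s, t; split=> //.
  transitivity (p (x + h *: v') - p x); first by rewrite /p; lra.
  rewrite Es -!mulrA; congr (h * _); rewrite -Et.
  rewrite derive_lin; [|exact: diff_derivable|exact: diff_derivable].
  rewrite mulN1r; congr (_ - _).
  exact: derive_translate.
apply/eqP; rewrite -subr_eq0 -normr_le0; apply/ler_addgt0Pl => e e0.
rewrite addr0.
have e2 : 0 < e / 2 by rewrite divr_gt0.
have /cvgrPdist_le/(_ _ e2) /nbhs_ballP[r /= r0 rG] := cG x.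
have /cvgrPdist_le/(_ _ e2) /nbhs_ballP[r' /= r'0 rH] := cH x.
pose M := `|v| + `|w| + 1.
have M0 : 0 < M by rewrite ltr_wpDl// addr_ge0.
(* This size keeps the whole parallelogram inside both balls of continuity; the 1 in [M] keeps it
   positive when [v] and [w] vanish, and the halving makes the inequality strict. *)
pose h := Num.min r r' / M / 2.
have rr0 : 0 < Num.min r r' by rewrite lt_min r0 r'0.
have h0 : 0 < h by rewrite !divr_gt0.
have hM : h * M < Num.min r r'.
  by rewrite /h mulrAC divfK ?gt_eqF// gtr_pMr// invf_lt1// ltr1n.
clearbody h; have small a b v' w' : `|v'| + `|w'| = `|v| + `|w| -> 0 <= a <= h -> 0 <= b <= h ->
    `|x - (x + a *: v' + b *: w')| < Num.min r r'.
  move=> vw /andP[a0 ah] /andP[b0 bh].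
  rewrite -addrA opprD addNKr normrN (le_lt_trans _ hM)//.
  rewrite (le_trans (ler_normD _ _))// !normrZ !ger0_norm//.
  rewrite (@le_trans _ _ (h * (`|v'| + `|w'|)))//.
    by rewrite mulrDr lerD// ler_wpM2r.
  by rewrite vw ler_wpM2l ?(ltW h0)// /M ltW// ltrDl.
have [s [t [sh th E]]] := key v w h dv h0.
have [s' [t' [sh' th' E']]] := key w v h dw h0.
have EE : G (x + s *: v + t *: w) = H (x + s' *: w + t' *: v).
  apply: (@mulfI _ (h * h)); first by rewrite mulf_neq0 ?gt_eqF.
  by rewrite -[LHS]E -[RHS]E' [x + h *: w + _]addrAC [X in _ = X + _]addrAC.
have {small} := (small s t v w erefl sh th, small s' t' w v (addrC _ _) sh' th').
rewrite !lt_min => -[/andP[A _] /andP[_ B]].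
have {}A : `|G x - G (x + s *: v + t *: w)| <= e / 2.
  by apply: rG; rewrite -ball_normE; exact: A.
have {}B : `|H x - H (x + s' *: w + t' *: v)| <= e / 2.
  by apply: rH; rewrite -ball_normE; exact: B.
rewrite -EE in B; exact: (ler_dist_half A B).
Qed.

(** Infinitesimal polarization. Splitting the innermost derivative as D_v + t D_w, the second
    summand contributes at t = 0 only through the derivative of its factor t, and the first one by
    induction; commutation of derivatives collects the [m] equal terms. *)
Lemma iderive_dir m f v w x : Ck m f ->
  is_derive (0 : R) 1 (fun t : R => iderive m (v + t *: w) f x)
    (m%:R * iderive m.-1 v ('D_w f) x).
Proof.
elim: m f => [f _|m IHm f Cf].
  by rewrite mul0r; exact: is_derive_cst.
have [df Df] := Cf.
have E : (fun t : R => iderive m.+1 (v + t *: w) f x) =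
    (fun t => iderive m (v + t *: w) ('D_v f) x) +
    (fun t => t * iderive m (v + t *: w) ('D_w f) x).
  apply/funext => t; rewrite iderivSr.
  have -> : 'D_(v + t *: w) f = fun y => 'D_v f y + t * 'D_w f y.
    by apply/funext => y; exact: deriveDdir.
  by rewrite iderive_lin//; [exact: Df|exact: Df].
have h1 := IHm _ (Df v); have h2 := IHm _ (Df w).
rewrite E.
have h3 := @is_deriveM R R id (fun t => iderive m (v + t *: w) ('D_w f) x) 0 1 1 _
   (is_derive_id _ _) h2.
apply: (is_derive_eq (is_deriveD h1 h3)).
rewrite !scale0r add0r addr0 [_%:A]mulr1 -natr1 mulrDl mul1r; congr (_ + _).
case: m Cf {Df IHm E h1 h2 h3} => [|m] Cf; first by rewrite !mul0r.
congr (_ * _); rewrite [iderive m.+2.-1 v _]iderivSr.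
apply: (congr1 (fun g => iderive m v g x)).
by apply/funext => y; apply: derive_comm; exact: CkW Cf.
Qed.

(** Differentiating the vanishing of D_v^m f (x) with respect to [v], in a direction of [S],
    replaces one [v] by that direction. The set [U] is open only relative to the directions in [S]:
    in the application these are the [eta]-directions inside the product with the [mu]-axis. *)
Lemma polarization (S U : set V) m f x : U !=set0 ->
  (forall v w, U v -> S w -> \forall t \near (0 : R), U (v + t *: w)) ->
  Ck m f -> (forall v, U v -> iderive m v f x = 0) ->
  forall vs : seq V, size vs = m -> (forall v, v \in vs -> S v) ->
  foldr (fun v (g : V -> R) => fun y => 'D_v g y) f vs x = 0.
Proof.
move=> [u Uu] opU; elim: m f => [f _ /(_ _ Uu) f0 [|//] _ _|m IHm f Cf f0 vs] //.
(* The last vector of the list is the innermost derivative, so peeling it off leaves the same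
   statement for 'D_w f. *)
case/lastP: vs => // s w; rewrite size_rcons => -[sm] Ss.
rewrite foldr_rcons.
have Sw : S w by apply: Ss; rewrite mem_rcons mem_head.
have [_ Df] := Cf.
apply: IHm => // [|v Uv|v vs]; [exact: Df| |by apply: Ss; rewrite mem_rcons inE vs orbT].
have [_ d0] := iderive_dir v w x Cf.
have : 'D_1 (fun t : R => iderive m.+1 (v + t *: w) f x) 0 = 'D_1 (fun=> 0 : R) (0 : R).
  apply: near_eq_derive; have := opU v w Uv Sw; apply: filterS => t; exact: f0.
by rewrite d0 derive_cst /= => /eqP; rewrite mulf_eq0 pnatr_eq0 => /eqP.
Qed.

End DirectionalDerivatives.

Section JointContinuity.
Context {R : realType} {V : normedModType R} {I : finType}.
Variables (b : I -> V) (c : I -> V -> R).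
Hypothesis c_cont : forall i, continuous (c i).
Hypothesis basis : forall v, v = \sum_i c i v *: b i.

Lemma derive_basis (f : V -> R) v x : differentiable f x ->
  'D_v f x = \sum_i c i v * 'D_(b i) f x.
Proof.
move=> df; rewrite deriveE// {1}[v]basis linear_sum; apply: eq_bigr => i _.
by rewrite linearZ deriveE.
Qed.

(** Below, the direction of differentiation moves together with the base point. A finite basis
    separates them: D_v is a combination of fixed derivatives with coefficients continuous in
    [v]. *)
Lemma iderive_joint_continuous m (f : V -> R) : Ck m f ->
  continuous (fun q : V * V => iderive m q.1 f q.2).
Proof.
elim: m f => [f cf q|m IHm f Cf].
  by apply: (@continuous_comp _ _ _ (@snd V V) f); [exact: cvg_snd|exact: cf].
have [df Df] := Cf.
have -> : (fun q : V * V => iderive m.+1 q.1 f q.2) =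
    fun q => \sum_i c i q.1 * iderive m q.1 ('D_(b i) f) q.2.
  apply/funext => q; rewrite iderivSr.
  have -> : 'D_q.1 f = fun y => \sum_i c i q.1 * 'D_(b i) f y.
    by apply/funext => y; exact: derive_basis.
  rewrite iderive_sum// => i; exact: Df.
move=> q; apply: cvg_big => [|i _]; first exact: add_continuous.
 apply: cvgM; last exact: IHm (Df _) q.
by apply: (@continuous_comp _ _ _ (@fst V V) (c i)); [exact: cvg_fst|exact: c_cont].
Qed.


(** Both ends [P] and [Q] move, so differentiability at [z] would not suffice. The mean value
    theorem gives a derivative in the direction P - Q at a point of the segment between them, and
    joint continuity of the derivative passes to the limit. *)
Lemma strict_derivative (T : Type) (F : set_system T) (FF : Filter F) (s : T -> R)
    (P Q : T -> V) (f : V -> R) z v : Ck 1 f ->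
  P @ F --> z -> Q @ F --> z -> (s t)^-1 *: (P t - Q t) @[t --> F] --> v ->
  (s t)^-1 * (f (P t) - f (Q t)) @[t --> F] --> 'D_v f z.
Proof.
move=> Cf Pz Qz PQv; have [df _] := Cf.
apply/cvgrPdist_le => e e0.
have /(_ (v, z))/cvgrPdist_le/(_ _ e0)/nbhs_ballP[r /= r0 rf] := iderive_joint_continuous Cf.
near=> t.
have [a /andP[a0 a1] E] := mean_value (Q t) (P t - Q t) df (@ler01 R).
move: E; rewrite scale1r [Q t + _]addrC subrK mul1r => ->.
rewrite -deriveZdir//; apply: (rf (_, _)); split.
  rewrite /= -ball_normE /ball_/=; near: t; exact: cvgr_dist_lt.
rewrite /= -ball_normE /ball_/=.
have -> : z - (Q t + a *: (P t - Q t)) = (1 - a) *: (z - Q t) + a *: (z - P t).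
  have -> : P t - Q t = (z - Q t) - (z - P t) by rewrite opprB [RHS]addrC addrA subrK.
  by rewrite opprD addrA scalerBr scalerBl scale1r opprB addrA addrAC.
rewrite (le_lt_trans (ler_normD _ _))// !normrZ ger0_norm ?subr_ge0// ger0_norm//.
have P1 : `|z - P t| < r by near: t; exact: cvgr_dist_lt.
have Q1 : `|z - Q t| < r by near: t; exact: cvgr_dist_lt.
have [->|an1] := eqVneq a 1; first by rewrite subrr mul0r add0r mul1r.
have a1' : 0 < 1 - a by rewrite subr_gt0 lt_neqAle an1.
rewrite [ltRHS](_ : r = (1 - a) * r + a * r); last by rewrite -mulrDl subrK mul1r.
by rewrite ltr_leD ?ltr_pM2l// ler_wpM2l// ltW.
Unshelve. all: by end_near. Qed.

(** Leading Taylor coefficient when base point and direction both depend on t: for each fixed t the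
    expansion is made along the segment from [y t] with velocity [v t], and joint continuity
    controls the m-th derivative on it. *)
Lemma flat_taylor_cvg (F : set_system R) (FF : Filter F) m (f : V -> R)
    (y v : R -> V) y0 v0 :
  (\forall t \near F, 0 < t) -> t @[t --> F] --> (0 : R) ->
  Ck m f -> y @ F --> y0 -> v @ F --> v0 ->
  (\forall t \near F, forall k, (k < m)%N -> iderive k (v t) f (y t) = 0) ->
  t ^- m * f (y t + t *: v t) @[t --> F] --> iderive m v0 f y0 / m`!%:R.
Proof.
move=> F0 Ft Cf yF vF flat; apply/cvgrPdist_le => d d0.
have f0 : 0 < m`!%:R :> R by rewrite ltr0n fact_gt0.
have fd0 : 0 < d * m`!%:R by rewrite mulr_gt0.
have /(_ (v0, y0))/cvgrPdist_le/(_ _ fd0)/nbhs_ballP[r /= r0 rf] :=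
  iderive_joint_continuous Cf.
have r2 : 0 < r / 2 by rewrite divr_gt0.
have tv : t *: v t @[t --> F] --> (0 : V).
  by rewrite -(scale0r v0); exact: cvgZ.
near=> t.
have t0 : 0 < t by near: t.
set L := iderive m v0 f y0.
pose g k (s : R) := iderive k (v t) f (y t + s *: v t).
have dg k z : (k < m)%N -> 0 <= z <= t -> is_derive z 1 (g k) (g k.+1 z).
  move=> km _; apply: is_derive_line; apply: diff_derivable.
  have [dk _] : Ck 1 (iderive k (v t) f) by apply: iderive_Ck; apply: CkW Cf; rewrite addn1.
  exact: dk.
have g0 k : (k < m)%N -> g k 0 = 0.
  by move=> km; rewrite /g scale0r addr0; move: k km; near: t.
have gz z : 0 <= z <= t -> L - d * m`!%:R <= g m z <= L + d * m`!%:R.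
  move=> /andP[z0 zt]; rewrite -ler_distlC; apply: (rf (_, _)); split => /=.
    by rewrite -ball_normE /ball_/=; near: t; exact: cvgr_dist_lt.
  rewrite -ball_normE /ball_/= opprD addrA (le_lt_trans (ler_normB _ _))//.
  rewrite (splitr r) ltr_leD//; first by near: t; exact: cvgr_dist_lt.
  rewrite (@le_trans _ _ `|t *: v t|)//.
    by rewrite !normrZ ler_wpM2r// !ger0_norm// ltW.
  by near: t; apply: cvgr0_norm_le.
have tt : 0 <= t <= t by rewrite ltW/=.
have gel := taylor_ge dg g0 (fun z zt => proj1 (andP (gz z zt))) tt.
have gle := taylor_le dg g0 (fun z zt => proj2 (andP (gz z zt))) tt.
have tm : 0 < t ^+ m by rewrite exprn_gt0.
rewrite ler_distlC; apply/andP; split.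
- rewrite ler_pdivlMl//; apply: le_trans gel; rewrite le_eqVlt; apply/orP; left.
  by apply/eqP; field; rewrite gt_eqF.
- rewrite ler_pdivrMl//; apply: (le_trans gle); rewrite le_eqVlt; apply/orP; left.
  by apply/eqP; field; rewrite gt_eqF.
Unshelve. all: by end_near. Qed.

End JointContinuity.

(** * Operators on jets *)

Section Jets.
Context {R : realType} {n : nat}.
Local Notation E := (R * 'rV[R]_n)%type.

Definition jet_basis (i : unit + 'I_n) : E :=
  match i with inl _ => (1, 0) | inr k => (0, delta_mx 0 k) end.
Definition jet_coord (i : unit + 'I_n) (v : E) : R :=
  match i with inl _ => v.1 | inr k => v.2 0 k end.

Lemma jet_coord_continuous i : continuous (jet_coord i).
Proof.
case: i => [u|k] v /=; first exact: cvg_fst.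
apply: (@continuous_comp _ _ _ (@snd R 'rV[R]_n) (fun M : 'rV[R]_n => M 0 k)).
  exact: cvg_snd.
exact: coord_continuous.
Qed.

Lemma jet_basisE v : v = \sum_i jet_coord i v *: jet_basis i.
Proof.
rewrite big_sumType /= (big_pred1 tt) => [|[]//].
case: v => d h /=.
have -> : \sum_(k < n) h 0 k *: ((0, delta_mx 0 k) : E) = (0, h).
  rewrite {2}[h]row_sum_delta; elim/big_rec2: _ => // k y1 y2 _ ->.
  by congr (_, _) => /=; rewrite scaler0 addr0.
by congr (_, _) => /=; rewrite ?scaler0 ?add0r// addr0 [_%:A]mulr1.
Qed.

Lemma cvg_rV (T : Type) (F : set_system T) {FF : Filter F} (f : T -> 'rV[R]_n) (l : 'rV[R]_n) :
  (forall k, f t 0 k @[t --> F] --> l 0 k) -> f @ F --> l.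
Proof.
move=> fl; apply/cvgrPdist_le => e e0; near=> t.
rewrite /Num.Def.normr/= mx_normrE (bigmax_le _ (ltW e0))//= => -[i k] _.
rewrite !mxE ord1 /=; move: k; near: t; apply: filter_forall => k.
by move/cvgrPdist_le : (fl k); apply.
Unshelve. all: by end_near. Qed.

Lemma cvg_near_eq (T : Type) (F : set_system T) {FF : Filter F}
    (U : Type) (f g : T -> U) (G : set_system U) :
  f @ F --> G -> (\forall t \near F, f t = g t) -> g @ F --> G.
Proof. by move=> fl fg; apply: cvg_trans fl; exact: near_eq_cvg. Qed.

Lemma cvg_jet (T : Type) (F : set_system T) {FF : Filter F} (m : T -> R)
    (p : T -> 'rV[R]_n) (c : R) (e : 'rV[R]_n) :
  m @ F --> c -> p @ F --> e -> (m t, p t) @[t --> F] --> (c, e).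
Proof. exact: (@cvg_pair T R 'rV[R]_n F (nbhs c) (nbhs e)). Qed.

Lemma derive_slice_mu (f : E -> R) (m : R) (p : 'rV[R]_n) :
  'D_1 (fun nu : R => f (nu, p)) m = 'D_(1, 0) f (m, p).
Proof.
rewrite /derive; suff -> :
  (fun h : R => h^-1 *: (((fun nu => f (nu, p)) \o shift m) (h *: 1) - f (m, p))) =
  (fun h => h^-1 *: ((f \o shift (m, p)) (h *: (1, 0)) - f (m, p))) by [].
apply/funext => h /=; congr (_ *: (f _ - _)); congr (_, _) => /=.
by rewrite scaler0 add0r.
Qed.

Lemma derive_slice_eta (f : E -> R) (m : R) (p v : 'rV[R]_n) :
  'D_v (fun eta => f (m, eta)) p = 'D_(0, v) f (m, p).
Proof.
rewrite /derive; suff -> :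
  (fun h : R => h^-1 *: (((fun eta => f (m, eta)) \o shift p) (h *: v) - f (m, p))) =
  (fun h => h^-1 *: ((f \o shift (m, p)) (h *: (0, v)) - f (m, p))) by [].
apply/funext => h /=; congr (_ *: (f _ - _)); congr (_, _) => /=.
by rewrite scaler0 add0r.
Qed.

Lemma jet_derive (f : E -> R) (z : E) d (h : 'rV[R]_n) : differentiable f z ->
  'D_(d, h) f z = d * 'D_(1, 0) f z + \sum_k h 0 k * 'D_(0, delta_mx 0 k) f z.
Proof.
move=> df; rewrite (derive_basis jet_basisE)// big_sumType /=.
by rewrite (big_pred1 tt) => [|[]].
Qed.

(** * First-order calculus for pairs of families with a common limit *)

Section PairLimits.
Context {T : Type} {F : set_system T} {FF : Filter F}.
Variable s : T -> R.
Implicit Types f g : T -> R.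

(** Here [d] is the variation of the pair at the rate [s]; it obeys the Leibniz and chain rules. The
    rate is t^i when two curves of solutions are compared, and the increment itself when a
    directional derivative is computed. *)
Definition plim (f g : T -> R) (c d : R) :=
  [/\ f @ F --> c, g @ F --> c & (s t)^-1 * (f t - g t) @[t --> F] --> d].

Lemma plim_near_eq f g f' g' c d : (\forall t \near F, f t = f' t) ->
  (\forall t \near F, g t = g' t) -> plim f g c d -> plim f' g' c d.
Proof.
move=> ff gg [fc gc fgd]; split; [exact: cvg_near_eq fc ff|exact: cvg_near_eq gc gg|].
by apply: (cvg_near_eq fgd); apply: filterS2 ff gg => t -> ->.
Qed.

Lemma plimD f1 g1 c1 d1 f2 g2 c2 d2 : plim f1 g1 c1 d1 -> plim f2 g2 c2 d2 ->
  plim (fun t => f1 t + f2 t) (fun t => g1 t + g2 t) (c1 + c2) (d1 + d2).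
Proof.
move=> [f1c g1c fg1] [f2c g2c fg2]; split; [exact: cvgD|exact: cvgD|].
rewrite (_ : (fun t => _) = fun t => (s t)^-1 * (f1 t - g1 t) + (s t)^-1 * (f2 t - g2 t)).
  exact: cvgD.
by apply/funext => t; rewrite -mulrDr; congr (_ * _); ring.
Qed.

Lemma plimM f1 g1 c1 d1 f2 g2 c2 d2 : plim f1 g1 c1 d1 -> plim f2 g2 c2 d2 ->
  plim (fun t => f1 t * f2 t) (fun t => g1 t * g2 t) (c1 * c2) (c1 * d2 + d1 * c2).
Proof.
move=> [f1c g1c fg1] [f2c g2c fg2]; split; [exact: cvgM|exact: cvgM|].
rewrite (_ : (fun t => _) = fun t => f1 t * ((s t)^-1 * (f2 t - g2 t)) +
    ((s t)^-1 * (f1 t - g1 t)) * g2 t).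
  by apply: cvgD; exact: cvgM.
by apply/funext => t; ring.
Qed.

Lemma plim_sum (I : Type) (r : seq I) (f g : I -> T -> R) (c d : I -> R) :
  (forall i, plim (f i) (g i) (c i) (d i)) ->
  plim (fun t => \sum_(i <- r) f i t) (fun t => \sum_(i <- r) g i t)
    (\sum_(i <- r) c i) (\sum_(i <- r) d i).
Proof.
move=> fg; elim: r => [|i r IHr].
  under [X in plim X _ _ _]eq_fun do rewrite big_nil.
  under [X in plim _ X _ _]eq_fun do rewrite big_nil.
  rewrite !big_nil; split; [exact: cvg_cst|exact: cvg_cst|].
  under eq_fun do rewrite subr0 mulr0; exact: cvg_cst.
under [X in plim X _ _ _]eq_fun do rewrite big_cons.
under [X in plim _ X _ _]eq_fun do rewrite big_cons.
rewrite !big_cons; exact: plimD.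
Qed.

Lemma plim_comp (f : E -> R) (m1 m2 : T -> R) (p1 p2 : T -> 'rV[R]_n) c d (e h : 'rV[R]_n) :
  Ck 1 f -> plim m1 m2 c d ->
  (forall k, plim (fun t => p1 t 0 k) (fun t => p2 t 0 k) (e 0 k) (h 0 k)) ->
  plim (fun t => f (m1 t, p1 t)) (fun t => f (m2 t, p2 t)) (f (c, e))
    ('D_(d, h) f (c, e)).
Proof.
move=> Cf [m1c m2c md] ph.
have P1 : (m1 t, p1 t) @[t --> F] --> (c, e).
  by apply: cvg_jet => //; apply: cvg_rV => k; have [] := ph k.
have P2 : (m2 t, p2 t) @[t --> F] --> (c, e).
  by apply: cvg_jet => //; apply: cvg_rV => k; have [] := ph k.
have cf := Ck_continuous Cf.
split; [exact: (cvg_comp _ _ P1 (cf _))|exact: (cvg_comp _ _ P2 (cf _))|].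
apply: (@strict_derivative R E _ _ _ jet_coord_continuous jet_basisE T F FF s
  (fun t => (m1 t, p1 t)) (fun t => (m2 t, p2 t)) f (c, e) (d, h) Cf P1 P2).
have -> : (fun t => (s t)^-1 *: ((m1 t, p1 t) - (m2 t, p2 t))) =
  (fun t => ((s t)^-1 * (m1 t - m2 t), (s t)^-1 *: (p1 t - p2 t))) by [].
apply: cvg_jet => //; apply: cvg_rV => k; have [_ _] := ph k.
by under [X in _ -> X @ _ --> _]eq_fun do rewrite !mxE.
Qed.

End PairLimits.

Section Operator.
Implicit Types (g : E -> R) (m : R) (p : 'rV[R]_n) (H : 'I_n -> 'I_n -> R).

(* The expression sum_i d_i (g(u, grad u) d_i u), expanded, as a function of
   the jet (m, p, H) = (u, grad u, D^2 u) of u at a point. *)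
Definition nondiv g m p H : R :=
  \sum_i (('D_(1, 0) g (m, p) * p 0 i +
           \sum_k 'D_(0, delta_mx 0 k) g (m, p) * H i k) * p 0 i
          + g (m, p) * H i i).

Lemma nondiv_sub g1 g2 m p H : Ck 1 g1 -> Ck 1 g2 ->
  nondiv g1 m p H - nondiv g2 m p H = nondiv (fun z => g1 z + (-1) * g2 z) m p H.
Proof.
move=> [d1 _] [d2 _].
have D v : 'D_v (fun z => g1 z + (-1) * g2 z) (m, p) = 'D_v g1 (m, p) - 'D_v g2 (m, p).
  by rewrite derive_lin ?mulN1r//; exact: diff_derivable.
rewrite /nondiv -sumrB; apply: eq_bigr => i _; rewrite D.
under [X in _ = (_ + X) * _ + _]eq_bigr do rewrite D mulrBl.
by rewrite sumrB; ring.
Qed.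

(** Linearization at a constant state: gradient and Hessian tend to 0, so by the Leibniz rule any
    term with two such factors has zero variation. Only g times the trace of the Hessian survives,
    which is where the Laplacian comes from. *)
Lemma nondiv_plim (T : Type) (F : set_system T) {FF : Filter F} (s : T -> R) g
    (m1 m2 : T -> R) (p1 p2 : T -> 'rV[R]_n) (H1 H2 : T -> 'I_n -> 'I_n -> R)
    c d dp dH : Ck 2 g ->
  plim (F := F) s m1 m2 c d ->
  (forall k, plim (F := F) s (fun t => p1 t 0 k) (fun t => p2 t 0 k) 0 (dp k)) ->
  (forall i k, plim (F := F) s (fun t => H1 t i k) (fun t => H2 t i k) 0 (dH i k)) ->
  (s t)^-1 * (nondiv g (m1 t) (p1 t) (H1 t) - nondiv g (m2 t) (p2 t) (H2 t))
    @[t --> F] --> g (c, 0) * \sum_i dH i i.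
Proof.
move=> Cg pm pp pH.
have cp := @plim_comp T F FF s.
pose h := \row_k dp k : 'rV[R]_n.
have pp' k : plim (F := F) s (fun t => p1 t 0 k) (fun t => p2 t 0 k) ((0 : 'rV[R]_n) 0 k) (h 0 k).
  by rewrite !mxE.
have pg := cp _ _ _ _ _ _ _ _ _ (CkW (isT : (1 <= 2)%N) Cg) pm pp'.
have pD v := cp _ _ _ _ _ _ _ _ _ (proj2 Cg v) pm pp'.
have := plim_sum (index_enum 'I_n) (fun i =>
  plimD (plimM (plimD (plimM (pD (1, 0)) (pp i))
     (plim_sum (index_enum 'I_n) (fun k => plimM (pD (0, delta_mx 0 k)) (pH i k)))) (pp i))
   (plimM pg (pH i i))).
move=> [_ _]; rewrite (_ : \sum_i _ = g (c, 0) * \sum_i dH i i)//.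
rewrite mulr_sumr; apply: eq_bigr => i _.
rewrite big1 => [|k _]; last exact: mulr0.
by rewrite !mulr0 !addr0 mul0r add0r.
Qed.

End Operator.

(** * Size of the operator when its coefficient is flat at zero gradient *)

Section FlatOperator.
Implicit Types (f : E -> R) (vs : seq 'rV[R]_n).

Definition eta_derive vs f : E -> R :=
  foldr (fun v (g : E -> R) => fun z => 'D_(0, v) g z) f vs.

Lemma eta_derive_nseq k v f : eta_derive (nseq k v) f = iderive k (0, v) f.
Proof. by elim: k => //= k ->. Qed.

Lemma eta_derive_Ck vs k f : Ck (size vs + k) f -> Ck k (eta_derive vs f).
Proof.
elim: vs k => // v vs IH k Cf.
have [_] : Ck k.+1 (eta_derive vs f) by apply: IH; rewrite addnS.
exact.
Qed.

Lemma iderive_deriveC m (v w : E) f : Ck m.+1 f ->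
  iderive m v ('D_w f) = 'D_w (iderive m v f).
Proof.
elim: m => // m IHm Cf.
rewrite [LHS](_ : _ = 'D_v (iderive m v ('D_w f)))// IHm; last exact: CkS.
apply/funext => z; apply: derive_comm; apply: iderive_Ck; apply: CkW Cf.
by rewrite addn2.
Qed.

(** Mixed lists of directions are allowed, not only powers of one direction, so that an
    [eta]-derivative of a flat function is flat again, one order lower. *)
Definition flat (m : nat) (f : E -> R) (mu : R) :=
  forall vs, (size vs < m)%N -> eta_derive vs f (mu, 0) = 0.

Lemma flat_iderive m f mu k v : flat m f mu -> (k < m)%N ->
  iderive k (0, v) f (mu, 0) = 0.
Proof. by move=> fl km; rewrite -eta_derive_nseq fl// size_nseq. Qed.

Lemma flat_derive_eta m f mu w : flat m f mu -> flat m.-1 ('D_(0, w) f) mu.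
Proof.
move=> fl vs sz; rewrite -[LHS](_ : eta_derive (rcons vs w) f (mu, 0) = _).
  by rewrite fl// size_rcons -ltn_predRL.
by rewrite /eta_derive foldr_rcons.
Qed.

(** No order is lost in [mu]: the [eta]-derivatives vanish identically along the [mu]-axis near
    [lam], hence so do their [mu]-derivatives, and the two kinds of derivative commute. Flatness at
    [lam] alone would say nothing here. *)
Lemma flat_derive_mu m f (lam : R) : Ck m f ->
  (\forall mu \near lam, flat m f mu) ->
  \forall mu \near lam, forall k (v : 'rV[R]_n), (k < m)%N ->
    iderive k (0, v) ('D_(1, 0) f) (mu, 0) = 0.
Proof.
move=> Cf /nbhs_interior; apply: filterS => mu fl k v km.
rewrite iderive_deriveC; last exact: CkW Cf.
transitivity ('D_1 (fun=> 0 : R) mu); last by rewrite derive_cst.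
rewrite -derive_slice_mu; by apply: near_eq_derive; move: fl; apply: filterS => nu flu;
   exact: (flat_iderive v flu km).
Qed.

(** The base point (mu t, 0) carries the motion in [mu], and the direction (0, p t / t) that in
    [eta], so only [eta]-derivatives occur in the expansion. *)
Lemma flat_cvg m f (lam : R) (om : 'rV[R]_n) (mu : R -> R) (p : R -> 'rV[R]_n) :
  Ck m f -> mu @ 0^'+ --> lam -> t^-1 *: p t @[t --> 0^'+] --> om ->
  (\forall t \near 0^'+, forall k v, (k < m)%N -> iderive k (0, v) f (mu t, 0) = 0) ->
  t ^- m * f (mu t, p t) @[t --> 0^'+] --> iderive m (0, om) f (lam, 0) / m`!%:R.
Proof.
move=> Cf mul pom fl.
have t0 : \forall t \near 0^'+, 0 < (t : R) by exact: nbhs_right_gt.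
have tcv : (t : R) @[t --> 0^'+] --> (0 : R) by exact: cvg_at_right_filter.
have := @flat_taylor_cvg R E _ _ _ jet_coord_continuous jet_basisE 0^'+ _ m f
  (fun t => (mu t, 0)) (fun t => (0, t^-1 *: p t)) (lam, 0) (0, om) t0 tcv Cf.
move=> /(_ _ (cvg_jet mul (cvg_cst _)) (cvg_jet (cvg_cst _) pom)) H.
apply: (cvg_near_eq (H _)).
  by move: fl; apply: filterS => t flt k km; exact: flt.
near=> t; congr (_ * f _); congr (_, _) => /=.
  by rewrite scaler0 addr0.
by rewrite add0r scalerA mulfV ?scale1r// gt_eqF.
Unshelve. all: by end_near. Qed.

(** Counting orders, with p = O(t) and H = o(t): the [mu]-derivative term is O(t^m) times p twice,
    the [eta]-derivative term is O(t^(m-1)) (O(1) when m = 0) times H times p, and the last term is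
    O(t^m) times H. Each is o(t^(m+1)). *)
Lemma nondiv_flat_cvg m f (lam : R) (om : 'rV[R]_n) (mu : R -> R)
    (p : R -> 'rV[R]_n) (H : R -> 'I_n -> 'I_n -> R) :
  Ck m.+1 f -> (\forall nu \near lam, flat m f nu) ->
  mu @ 0^'+ --> lam -> t^-1 *: p t @[t --> 0^'+] --> om ->
  (forall i k, t^-1 * H t i k @[t --> 0^'+] --> 0) ->
  t ^- m.+1 * nondiv f (mu t) (p t) (H t) @[t --> 0^'+] --> 0.
Proof.
move=> Cf fl mul pom Ht.
have flm : \forall t \near 0^'+, flat m f (mu t) by exact: (mul _ fl).
have tcv : (t : R) @[t --> 0^'+] --> (0 : R) by exact: cvg_at_right_filter.
have pc k : t^-1 * p t 0 k @[t --> 0^'+] --> om 0 k.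
  apply: (cvg_near_eq (cvg_comp _ _ pom (@coord_continuous _ _ _ 0 k om))).
  by near=> t; rewrite /= mxE.
have cA : t ^- m * 'D_(1, 0) f (mu t, p t) @[t --> 0^'+] -->
    iderive m (0, om) ('D_(1, 0) f) (lam, 0) / m`!%:R.
  apply: flat_cvg => //; first exact: (proj2 Cf).
  by apply: (mul _ (flat_derive_mu _ fl)); exact: CkS.
have cB w : t ^- m.-1 * 'D_(0, w) f (mu t, p t) @[t --> 0^'+] -->
    iderive m.-1 (0, om) ('D_(0, w) f) (lam, 0) / m.-1`!%:R.
  apply: flat_cvg => //; first by apply: CkW (proj2 Cf _); exact: leq_pred.
  by move: flm; apply: filterS => t /(flat_derive_eta w) flt k v; exact: flat_iderive.
have cC : t ^- m * f (mu t, p t) @[t --> 0^'+] --> iderive m (0, om) f (lam, 0) / m`!%:R.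
  apply: flat_cvg => //; first exact: CkS.
  by move: flm; apply: filterS => t flt k v; exact: flat_iderive.
have pc0 k : p t 0 k @[t --> 0^'+] --> (0 : R).
  have tp := cvgM tcv (pc k); rewrite mul0r in tp.
  apply: (cvg_near_eq (tp _)); near=> t => /=.
  by rewrite mulrA mulfV ?mul1r// gt_eqF.
pose T i t : R := (t ^- m * 'D_(1, 0) f (mu t, p t) * p t 0 i +
    \sum_k (t * (t ^- m * 'D_(0, delta_mx 0 k) f (mu t, p t))) * (t^-1 * H t i k)) *
   (t^-1 * p t 0 i) + (t ^- m * f (mu t, p t)) * (t^-1 * H t i i).
(* The value of [L] is irrelevant, since it multiplies a factor tending to 0. The case m = 0 is
   separate because [m.-1] is then 0 and the extra factor t is not absorbed. *)
have [L cL] : exists L : 'rV[R]_n -> R, forall w,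
    t * (t ^- m * 'D_(0, w) f (mu t, p t)) @[t --> 0^'+] --> L w.
  case: m {Cf fl flm cA cC T} cB => [|m] cB.
    by exists (fun=> 0) => w; have := cvgM tcv (cB w); rewrite mul0r; apply.
  exists (fun w => iderive m (0, om) ('D_(0, w) f) (lam, 0) / m`!%:R) => w.
  apply: (cvg_near_eq (cB w)); near=> t => /=.
  by rewrite exprS invfM !mulrA mulfV ?mul1r// gt_eqF.
suff cT : \sum_i T i t @[t --> 0^'+] --> (0 : R).
  apply: (cvg_near_eq cT); near=> t.
  have tn0 : t != 0 by rewrite gt_eqF.
  rewrite /nondiv mulr_sumr; apply: eq_bigr => i _; rewrite /T; apply/esym.
  rewrite mulrDr; congr (_ + _); last by rewrite exprS invfM; ring.
  rewrite [LHS]mulrA [RHS]mulrA; congr (_ * _).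
  rewrite [LHS]mulrDr [RHS]mulrDl; congr (_ + _).
    by rewrite exprS invfM; ring.
  rewrite [RHS]mulr_suml mulr_sumr; apply: eq_bigr => k _.
  by rewrite exprS invfM; field; rewrite ?expf_neq0 ?tn0.
rewrite [X in _ --> X](_ : _ = \sum_(i < n) (0 : R)); last by rewrite big1.
apply: cvg_big => [|i _]; first exact: add_continuous.
rewrite -[X in _ --> X](_ : (iderive m (0, om) ('D_(1, 0) f) (lam, 0) / m`!%:R * 0 +
   \sum_(k < n) L (delta_mx 0 k) * 0) * om 0 i
   + (iderive m (0, om) f (lam, 0) / m`!%:R) * 0 = 0).
  apply: cvgD; last exact: cvgM.
  apply: cvgM => //; apply: cvgD; first exact: cvgM.
  apply: cvg_big => [|k _]; first exact: add_continuous.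
  by apply: cvgM.
by rewrite !mulr0 big1 ?addr0 ?mul0r// => k _; rewrite mulr0.
Unshelve. all: by end_near. Qed.

End FlatOperator.

End Jets.


(** * Functions of class C^k on the closure *)

Section ClosureDerivatives.
Context {R : realType} {n : nat}.
Variable D : set 'rV[R]_n.
Hypothesis Dopen : open D.
Implicit Types (f g : 'rV[R]_n -> R) (s : seq 'I_n) (x : 'rV[R]_n) (c : R).

Lemma near_open x : D x -> \forall y \near x, D y.
Proof. by move=> Dx; exact: open_nbhs_nbhs. Qed.

Lemma near_line x v : D x -> \forall t \near (0 : R), D (x + t *: v).
Proof.
move=> Dx; have xt : (x + t *: v) @[t --> (0 : R)] --> x.
  rewrite -[X in _ --> X]addr0 -(scale0r v); apply: cvgD; first exact: cvg_cst.
  by apply: cvgZr_tmp; exact: cvg_id.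
by apply: xt; exact: open_nbhs_nbhs.
Qed.

Lemma partials_lin k f g c s x : Ck_closure D k f -> Ck_closure D k g ->
  (size s <= k)%N -> D x ->
  partials s (fun y => f y + c * g y) x = partials s f x + c * partials s g x.
Proof.
move=> [_ df _] [_ dg _]; elim: s x => // i s IHs x sk Dx.
rewrite /= {1}/partial (@near_eq_derive _ _ _ _ (fun y => partials s f y + c * partials s g y)).
  by apply: derive_lin; [exact: df|exact: dg].
by have := near_open Dx; apply: filterS => y; apply: IHs; exact: ltnW.
Qed.

Lemma partials_eq f g s x : (forall y, D y -> f y = g y) -> D x ->
  partials s f x = partials s g x.
Proof.
move=> fg; elim: s x => [x|i s IHs x Dx]; first exact: fg.
apply: near_eq_derive; have := near_open Dx; apply: filterS => y; exact: IHs.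
Qed.

Lemma Ck_closure_lin k f g c : Ck_closure D k f -> Ck_closure D k g ->
  Ck_closure D k (fun y => f y + c * g y).
Proof.
move=> Cf Cg; have [cf df ef] := Cf; have [cg dg eg] := Cg; split.
- move=> y; apply: cvgD; first exact: cf.
  by apply: cvgM; [exact: cvg_cst|exact: cg].
- move=> s i x sk Dx.
  apply: (@near_eq_derivable _ _ _ (partials s f + c *: partials s g)).
    have := near_open Dx; apply: filterS => y Dy.
    by rewrite (partials_lin c Cf Cg (ltnW sk) Dy).
  by apply: derivableD; [exact: df|apply: derivableZ; exact: dg].
- move=> s sk; have [f' cf' ef'] := ef s sk; have [g' cg' eg'] := eg s sk.
  exists (fun y => f' y + c * g' y).
    move=> y; apply: cvgD; first exact: cf'.
    by apply: cvgM; [exact: cvg_cst|exact: cg'].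
  by move=> x Dx; rewrite (partials_lin c Cf Cg sk Dx) ef'// eg'.
Qed.

Lemma cvg_within_eq f g x (G : set_system R) : (forall y, D y -> f y = g y) ->
  f y @[y --> within D (nbhs x)] --> G -> g y @[y --> within D (nbhs x)] --> G.
Proof.
move=> fg fG; apply: (cvg_near_eq fG).
by rewrite near_withinE; apply: nearW => y; exact: fg.
Qed.

Lemma cvg_within_closure f x : {within closure D, continuous f} -> closure D x ->
  f y @[y --> within D (nbhs x)] --> f x.
Proof.
move=> /subspace_continuousP + Dx => /(_ x Dx) fx A /fx.
change (nbhs x (fun y => closure D y -> A (f y)) -> nbhs x (fun y => D y -> A (f y))).
by apply: filterS => y yA Dy; apply: yA; exact: subset_closure.
Qed.

Lemma clext_eq f g s x : (forall y, D y -> f y = g y) ->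
  clext D (partials s f) x = clext D (partials s g) x.
Proof.
move=> fg; rewrite /clext; congr (lim _).
(* The image filters themselves coincide, so no convergence is required. *)
apply/seteqP; split.
  exact: (cvg_within_eq (fun y Dy => partials_eq s fg Dy) (fun A fA => fA)).
exact: (cvg_within_eq (fun y Dy => esym (partials_eq s fg Dy)) (fun A fA => fA)).
Qed.

Lemma clextE k f s x : Ck_closure D k f -> (size s <= k)%N -> closure D x ->
  exists g, [/\ {within closure D, continuous g}, forall y, D y -> g y = partials s f y
    & clext D (partials s f) x = g x].
Proof.
move=> [_ _ ef] sk Dx; have [g cg eg] := ef s sk; exists g; split=> //.
have FF : ProperFilter (within D (nbhs x)) by exact: within_nbhs_proper.
apply: cvg_lim; first exact: norm_hausdorff.
exact: (cvg_within_eq eg (cvg_within_closure cg Dx)).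
Qed.

Lemma clext_cvg k f s x : Ck_closure D k f -> (size s <= k)%N -> closure D x ->
  partials s f y @[y --> within D (nbhs x)] --> clext D (partials s f) x.
Proof.
move=> Cf sk Dx; have [g [cg eg ->]] := clextE Cf sk Dx.
exact: (cvg_within_eq eg (cvg_within_closure cg Dx)).
Qed.

Lemma clext_in k f s x : Ck_closure D k f -> (size s <= k)%N -> D x ->
  clext D (partials s f) x = partials s f x.
Proof.
move=> Cf sk Dx; have [g [cg eg ->]] := clextE Cf sk (subset_closure Dx).
exact: eg.
Qed.

Lemma clext_nil k f x : Ck_closure D k f -> closure D x -> clext D (partials [::] f) x = f x.
Proof.
move=> [cf _ _] Dx.
have FF : ProperFilter (within D (nbhs x)) by exact: within_nbhs_proper.
apply: cvg_lim; first exact: norm_hausdorff.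
exact: cvg_within_closure.
Qed.

Lemma clext_lin k f g c s x : Ck_closure D k f -> Ck_closure D k g ->
  (size s <= k)%N -> closure D x ->
  clext D (partials s (fun y => f y + c * g y)) x =
  clext D (partials s f) x + c * clext D (partials s g) x.
Proof.
move=> Cf Cg sk Dx.
have FF : ProperFilter (within D (nbhs x)) by exact: within_nbhs_proper.
apply: cvg_lim; first exact: norm_hausdorff.
have H := cvgD (clext_cvg Cf sk Dx) (cvgM (cvg_cst c) (clext_cvg Cg sk Dx)).
apply: (cvg_within_eq _ (H _ _ _)) => y Dy.
by rewrite (partials_lin c Cf Cg sk Dy).
Qed.

Lemma clext_le k f s x : Ck_closure D k f -> (size s <= k)%N -> closure D x ->
  (`|clext D (partials s f) x|%:E <= ereal_sup [set `|partials s f y|%:E | y in D])%E.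
Proof.
move=> Cf sk Dx.
have FF : ProperFilter (within D (nbhs x)) by exact: within_nbhs_proper.
have := clext_cvg Cf sk Dx; set l := clext _ _ _ => fl.
have ub y : D y -> (`|partials s f y|%:E <= ereal_sup [set `|partials s f y|%:E | y in D])%E.
  by move=> Dy; apply: ereal_sup_ubound; exists y.
move: ub; case: (ereal_sup _) => [r| |] ub; last 2 first.
- by rewrite leey.
- have [y [Dy _]] : D `&` setT !=set0 by apply: Dx; exact: filterT.
  by have := ub y Dy.
rewrite lee_fin.
apply: (@closed_cvg _ _ _ _ _ _ (@closed_le R r) _ _ (cvg_norm fl)).
by rewrite near_withinE; apply: nearW => y /ub; rewrite lee_fin.
Qed.

Lemma sup_ge0 (T : Type) (A : set T) (F : T -> R) : A !=set0 -> (forall y, 0 <= F y) ->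
  (0 <= ereal_sup [set (F y)%:E | y in A])%E.
Proof.
move=> [y Ay] F0; apply: (@le_trans _ _ (F y)%:E); first by rewrite lee_fin.
by apply: ereal_sup_ubound; exists y.
Qed.

Hypothesis D2 : exists x y, [/\ D x, D y & x != y].

(** The sup norms are bounded by the full norm only if the Hölder quotients contribute
    nonnegatively: their supremum over an empty set of pairs would be -oo, which [D2] rules out. *)
Lemma sup_le_holder_norm k (alpha : R) f s : (size s <= k)%N ->
  (ereal_sup [set `|partials s f y|%:E | y in D] <= holder_norm D k alpha f)%E.
Proof.
move=> sk; have [x [y [Dx Dy xy]]] := D2.
have D0 : D !=set0 by exists x.
have S0 (s' : seq 'I_n) : (0 <= ereal_sup [set `|partials s' f y|%:E | y in D])%E.
  by apply: sup_ge0 => // z; exact: normr_ge0.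
rewrite /holder_norm; apply: (@le_trans _ _ (\sum_(m < k.+1) \sum_(s0 : m.-tuple 'I_n)
      ereal_sup [set `|partials s0 f x|%:E | x in D])%E); last first.
  apply: leeDl; apply: sume_ge0 => s' _; apply: sup_ge0; first by exists (x, y).
  by move=> z; rewrite divr_ge0// powR_ge0.
rewrite (bigD1 (Ordinal (sk : (size s < k.+1)%N)))//=.
rewrite (bigD1 (in_tuple s))//= -addeA; apply: leeDl.
apply: adde_ge0; first by apply: sume_ge0 => s' _.
by apply: sume_ge0 => m _; apply: sume_ge0 => s' _.
Qed.

Lemma clext_le_holder_norm k (alpha : R) f s x : Ck_closure D k f ->
  (size s <= k)%N -> closure D x ->
  (`|clext D (partials s f) x|%:E <= holder_norm D k alpha f)%E.
Proof.
move=> Cf sk Dx; exact: le_trans (clext_le Cf sk Dx) (sup_le_holder_norm _ _ sk).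
Qed.

End ClosureDerivatives.

(** * From Hölder-valued curves to real functions of the parameter *)

Section Curves.
Context {R : realType} {n : nat}.
Variable D : set 'rV[R]_n.
Hypothesis Dopen : open D.
Hypothesis D2 : exists x y, [/\ D x, D y & x != y].

Lemma clext_near0 k (alpha : R) (G : set_system R) {FG : Filter G}
    (f : R -> 'rV[R]_n -> R) s x d : 0 < d ->
  (size s <= k)%N -> closure D x ->
  holder_norm D k alpha (f t) @[t --> G] --> 0%E ->
  (\forall t \near G, Ck_closure D k (f t)) ->
  \forall t \near G, `|clext D (partials s (f t)) x| <= d.
Proof.
move=> d0 sk Dx f0 Cf.
have fd : \forall t \near G, (holder_norm D k alpha (f t) < d%:E)%E.
  have /f0 : ereal_nbhs 0%E [set y | (y < d%:E)%E] by apply: open_ereal_lt'; rewrite lte_fin.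
  by [].
move: fd Cf; apply: filterS2 => t ft Ct; rewrite -lee_fin.
exact: le_trans (clext_le_holder_norm D2 alpha Ct sk Dx) (ltW ft).
Qed.

(** Evaluating an extended partial derivative at a point of the closure is linear and bounded by the
    Hölder norm, hence commutes with differentiation in t. The real-valued conclusions are all that
    is used of the curve afterwards. *)
Lemma holder_curve_derivatives l k (alpha e : R) u : 0 < e ->
  holder_curve_C l D k alpha e u ->
  exists U : nat -> R -> 'rV[R]_n -> R,
  [/\ U 0%N = u,
      forall j t, (j <= l)%N -> - e < t < e -> Ck_closure D k (U j t)
    & forall s x, (size s <= k)%N -> closure D x ->
      (forall j t, (j < l)%N -> - e < t < e ->
         is_derive t 1 (fun r => clext D (partials s (U j r)) x)
           (clext D (partials s (U j.+1 t)) x)) /\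
      {for 0, continuous (fun r => clext D (partials s (U l r)) x)}].
Proof.
move=> e0; elim: l u => [u [Cu cu]|l IHl u [Cu [du /IHl [U [U0 CU dU]] hdu]]].
  exists (fun=> u); split=> // [j t _ te|s x sk Dx]; first by have [] := Cu t te.
  split=> //; apply/cvgrPdist_le => d d0.
  have e00 : - e < 0 < e by rewrite oppr_lt0 e0.
  have ne : \forall r \near (0 : R), - e < r < e.
    by apply: near_in_itvoo; rewrite in_itv.
  have [C0 _] := Cu 0 e00.
  have E r : (fun x0 => u r x0 - u 0 x0) = (fun x0 => u r x0 + (-1) * u 0 x0).
    by apply/funext => y; rewrite mulN1r.
  have H := @clext_near0 k alpha (nbhs (0:R)) _ (fun r x0 => u r x0 - u 0 x0) s x d d0 sk Dx (cu 0 e00).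
  near=> r; rewrite distrC.
  have re : - e < r < e by near: r.
  have [Cr _] := Cu r re.
  rewrite -mulN1r -(clext_lin Dopen _ Cr C0 sk Dx) -E; near: r; apply: H.
  move: ne; apply: filterS => r re; have [Cr _] := Cu r re.
  by rewrite E; exact: (Ck_closure_lin Dopen).
exists (fun j => if j is j'.+1 then U j' else u); split=> //.
  move=> [|j] t jl te; first by have [] := Cu t te.
  exact: CU.
move=> s x sk Dx; have [dU1 dU2] := dU s x sk Dx; split; last exact: dU2.
move=> [|j] t jl te; last exact: (dU1 j t jl te).
apply/is_deriveP/cvgrPdist_le => d d0; rewrite U0.
have [Ct _] := Cu t te.
have Cdt : Ck_closure D k (du t) by rewrite -U0; exact: CU.
(* Linearity is available for f + c g only, so h^-1 w is written as w + (h^-1 - 1) w. *)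
have E h : (fun x => h^-1 * (u (t + h) x - u t x) - du t x) =
  (fun x => (fun y => (fun z => u (t + h) z + (h^-1 - 1) * u (t + h) z) y + (- h^-1) * u t y) x
    + (-1) * du t x) by apply/funext => y; ring.
have H := @clext_near0 k alpha (0 : R)^' _ _ s x d d0 sk Dx (hdu t te).
have nh : \forall h \near (0 : R)^', - e < t + h < e.
  have [te1 te2] := andP te.
  have d1 : 0 < Num.min (t + e) (e - t) by rewrite lt_min -ltrBlDr sub0r te1 subr_gt0.
  near=> h.
  have : `|h| < Num.min (t + e) (e - t) by near: h; exact: dnbhs0_lt.
  rewrite lt_min !ltr_norml => /andP[].
  by move=> /andP[h1 _] /andP[_ h2]; apply/andP; split; lra.
near=> h; rewrite distrC.
have the : - e < t + h < e by near: h.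
have [Cth _] := Cu _ the.
have C1 := Ck_closure_lin Dopen (h^-1 - 1) Cth Cth.
have C2 := Ck_closure_lin Dopen (- h^-1) C1 Ct.
have -> : h *: 1 + t = t + h by rewrite [h *: 1]mulr1 addrC.
rewrite (_ : _ - _ = clext D (partials s (fun x => h^-1 * (u (t + h) x - u t x) - du t x)) x).
  near: h; apply: H.
  move: nh; apply: filterS => h hte; have [Ch _] := Cu _ hte.
  rewrite E; apply: (Ck_closure_lin Dopen _ _ Cdt).
  exact: (Ck_closure_lin Dopen _ (Ck_closure_lin Dopen _ Ch Ch) Ct).
rewrite E (clext_lin Dopen _ C2 Cdt sk Dx) (clext_lin Dopen _ C1 Ct sk Dx) (clext_lin Dopen _ Cth Cth sk Dx).
by rewrite /GRing.scale /=; ring.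
Unshelve. all: by end_near. Qed.

End Curves.

(** * Maximum principle *)

Section MaximumPrinciple.
Context {R : realType} {n : nat}.

(** At the maximum f' vanishes; were its slope [c] positive, f' would be positive just to the right
    of 0 and [f] would increase there. *)
Lemma second_derivative_max (f : R -> R) (c : R) :
  (\forall t \near (0 : R), derivable f t 1) -> is_derive (0 : R) 1 ('D_1 f) c ->
  (\forall t \near (0 : R), f t <= f 0) -> c <= 0.
Proof.
move=> df /is_deriveP d2f fmax; rewrite leNgt; apply/negP => c0.
have /nbhs_ballP[r /= r0 rP] : \forall t \near (0 : R), derivable f t 1 /\ f t <= f 0.
  by near=> t; split; near: t.
have inr t : - r < t < r -> ball (0 : R) r t.
  by rewrite /ball /= sub0r normrN ltr_norml.
have d0 : 'D_1 f 0 = 0.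
  have [] // := @derive1_at_max R f (- r) r 0.
  - by rewrite ge0_cp// ltW.
  - by move=> t; rewrite in_itv /= => /inr/rP[].
  - by rewrite in_itv /= oppr_lt0 r0.
  - by move=> t; rewrite in_itv /= => /inr/rP[].
have /cvgrPdist_lt/(_ _ c0) : t^-1 *: ('D_1 f (t *: 1 + 0) - 'D_1 f 0) @[t --> 0^'+] --> c.
  exact: (cvg_dnbhs_at_right d2f).
rewrite near_withinE => /nbhs_ballP[r' /= r'0 r'P].
have fpos t : 0 < t < r' -> 0 < 'D_1 f t.
  move=> /andP[t0 tr].
  have := r'P t; rewrite /ball /= sub0r normrN gtr0_norm// => /(_ tr t0).
  rewrite d0 subr0 addr0 [t *: 1]mulr1 ltr_distlC subrr => /andP[+ _].
  by rewrite pmulr_rgt0// invr_gt0.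
pose m := Num.min r r' / 2.
have rr0 : 0 < Num.min r r' by rewrite lt_min r0 r'0.
have m0 : 0 < m by rewrite divr_gt0.
have [mr mr'] : m < r /\ m < r'.
  have : m < Num.min r r' by rewrite gtr_pMr// invf_lt1// ltr1n.
  by rewrite lt_min => /andP[].
have inr' t : 0 <= t <= m -> ball (0 : R) r t.
  move=> /andP[t0 tm]; apply: inr; rewrite (le_lt_trans tm)// andbT.
  by rewrite (lt_le_trans _ t0)// oppr_lt0.
have [] := @MVT R f ('D_1 f) 0 m m0.
- move=> t; rewrite in_itv /= => /andP[t0 tm]; apply/derivableP.
  by have [] := rP t (inr' t (introT andP (conj (ltW t0) (ltW tm)))).
- apply: derivable_within_continuous => t; rewrite in_itv /= => tm.
  by have [] := rP t (inr' _ tm).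
move=> t; rewrite in_itv /= => /andP[t0 tm] E.
have : f m <= f 0 by have [] := rP m (inr' m (introT andP (conj (ltW m0) (lexx m)))).
rewrite leNgt => /negP; apply; rewrite -subr_gt0 E subr0 mulr_gt0// fpos//.
by rewrite t0 (lt_trans tm).
Unshelve. all: by end_near. Qed.

Lemma is_derive_affine (a b t : R) : is_derive t 1 (fun r : R => a + b * r) b.
Proof.
apply: is_derive_eq (is_derive_lin b (is_derive_cst a t 1) (is_derive_id t 1)) _.
by rewrite add0r mulr1.
Qed.

Lemma is_derive_affine_sqr (a b t : R) :
  is_derive t 1 (fun r : R => (a + b * r) ^+ 2) (2 * b * a + 2 * b ^+ 2 * t).
Proof.
apply: is_derive_eq (is_deriveM (is_derive_affine a b t) (is_derive_affine a b t)) _.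
by rewrite /GRing.scale /=; ring.
Qed.

Lemma closure_compact (Omega : set 'rV[R]_n) : bounded_set Omega -> compact (closure Omega).
Proof.
move=> bO; apply: bounded_closed_compact; last exact: closed_closure.
have [M [Mr MO]] := bO; exists (M + 2); split; first by rewrite realD.
move=> x Mx y Oy /=.
have [z [Oz yz]] := Oy _ (nbhsx_ballx y 1 ltr01).
have zM : `|z| <= M + 1 by apply: MO => //; rewrite ltrDl.
move: yz; rewrite -ball_normE /ball_/= => yz.
rewrite -(subrK z y) (le_trans (ler_normD _ _))// (le_trans _ (ltW Mx))//.
by rewrite addrC (_ : M + 2 = M + 1 + 1) ?lerD ?(ltW yz)//; ring.
Qed.

Lemma boundary_closure (Omega : set 'rV[R]_n) x : open Omega -> closure Omega x ->
  Omega x \/ boundary Omega x.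
Proof.
move=> opO cx; case: (pselect (Omega x)) => Ox; [by left|right].
by split=> //; move: opO => /interior_id ->.
Qed.

(** Adding a small multiple of the square of one coordinate makes the Laplacian strictly positive,
    which excludes an interior maximum; the perturbation is then absorbed in an arbitrary [d]. *)
Lemma harmonic_le0 (Omega : set 'rV[R]_n) W (i0 : 'I_n) : bounded_domain Omega ->
  Ck_closure Omega 2 W ->
  (forall x, Omega x -> \sum_i partials [:: i; i] W x = 0) ->
  (forall x, boundary Omega x -> W x = 0) ->
  forall x, closure Omega x -> W x <= 0.
Proof.
move=> [nO opO _ bO] [cW dW _] hW bW x0 cx0.
have cO := closure_compact bO.
have cO0 : closure Omega !=set0 by exists x0.
pose q (x : 'rV[R]_n) := x 0 i0 ^+ 2.
have cq : continuous q.
  move=> x; apply: (@continuousM R _ (fun y : 'rV[R]_n => y 0 i0) (fun y => y 0 i0)).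
    exact: coord_continuous.
  exact: coord_continuous.
have q0 x : 0 <= q x by rewrite sqr_ge0.
have [xm _ qm] := EVT_max_rV cO0 cO (continuous_subspaceT cq).
apply/ler_addgt0Pl => d d0; rewrite addr0.
(* Since [xm] maximizes [q], this gives e q <= d on the whole closure; the 1 avoids a division by
   zero. *)
pose e := d / (q xm + 1).
have q1 : 0 < q xm + 1 by rewrite ltr_wpDl.
have e0 : 0 < e by rewrite divr_gt0.
pose v x := W x + e * q x.
have cv : {within closure Omega, continuous v}.
  move=> y; apply: cvgD; first exact: cW.
  by apply: cvgM; [exact: cvg_cst|exact: (continuous_subspaceT cq)].
have [c + vm] := EVT_max_rV cO0 cO cv; rewrite inE => cc.
have [Oc|bc] := boundary_closure opO cc; last first.
  have cxv : W x0 <= v x0 by rewrite /v lerDl mulr_ge0// ltW.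
  have {}vm : v x0 <= v c by apply: vm; rewrite inE.
  apply: (le_trans cxv); apply: (le_trans vm); rewrite /v bW// add0r.
  rewrite -[leRHS](divfK (lt0r_neq0 q1)) ler_wpM2l ?(ltW e0)//.
  by rewrite (@le_trans _ _ (q xm)) ?lerDl// qm// inE.
exfalso.
(* Kronecker symbol: the second derivative of e q along the i-th axis is 2 e (b i)^2. Summed over i,
   the bounds of [key] give 2 e <= 0, a contradiction. *)
pose b (i : 'I_n) : R := (i == i0)%:R.
suff key i : partials [:: i; i] W c + e * 2 * b i ^+ 2 <= 0.
  have : \sum_i (partials [:: i; i] W c + e * 2 * b i ^+ 2) <= 0 by exact: sumr_le0.
  rewrite big_split /= hW// add0r -mulr_sumr (bigD1 i0)//= big1 => [|i /negbTE]; last first.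
    by rewrite /b => ->; rewrite expr0n.
  by rewrite addr0 /b eqxx expr1n mulr1 leNgt mulr_gt0.
pose ei : 'rV[R]_n := delta_mx 0 i.
pose f (t : R) := W (c + t *: ei) + e * (c 0 i0 + b i * t) ^+ 2.
have fE t : f t = v (c + t *: ei).
  by rewrite /f /v /q !mxE eqxx /= /b [i == i0]eq_sym [t * _]mulrC.
have ctO : \forall t \near (0 : R), Omega (c + t *: ei).
  exact: near_line.
have df (t : R) : Omega (c + t *: ei) -> is_derive t 1 f
    (partial i W (c + t *: ei) + e * (2 * b i * c 0 i0 + 2 * b i ^+ 2 * t)).
  move=> Ot; apply: is_derive_lin; last exact: is_derive_affine_sqr.
  by apply: is_derive_line; exact: (dW [::]).
apply: (@second_derivative_max f).
- by move: ctO; apply: filterS => t Ot; have [] := df t Ot.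
- apply: (@near_eq_is_derive _ _ _
    (fun t : R => partial i W (c + t *: ei) + e * (2 * b i * c 0 i0 + 2 * b i ^+ 2 * t))).
    by move: ctO; apply: filterS => t Ot; have [_ ->] := df t Ot.
  rewrite -[e * 2 * _]mulrA; apply: is_derive_lin.
    rewrite -[X in partials _ _ X]addr0 -(scale0r ei).
    by apply: is_derive_line; rewrite scale0r addr0; exact: (dW [:: i]).
  exact: is_derive_affine.
- have f0 : f 0 = v c by rewrite fE scale0r addr0.
  move: ctO; apply: filterS => t Ot; rewrite f0 fE; apply: vm; rewrite inE.
  exact: subset_closure.
Qed.

End MaximumPrinciple.

Section AffineFunctions.
Context {R : realType} {n : nat}.
Variable D : set 'rV[R]_n.
Implicit Types (c : R) (om : 'rV[R]_n).

Lemma partials_cst (s : seq 'I_n) c :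
  partials s (fun _ : 'rV[R]_n => c) = fun=> if s is [::] then c else 0.
Proof.
elim: s => // i s IH; rewrite /= IH; apply/funext => x.
by rewrite /partial derive_cst.
Qed.

Lemma partial_cst i c : partial i (fun _ : 'rV[R]_n => c) = fun=> 0.
Proof. exact: (partials_cst [:: i] c). Qed.

Lemma is_derive_dirichlet_data c om (t : R) x i :
  is_derive x (delta_mx 0 i) (dirichlet_data c om t) (t * om 0 i).
Proof.
apply/is_deriveP; apply: (cvg_near_eq (cvg_cst _)); near=> h.
have h0 : h != 0 by near: h; exact: nbhs_dnbhs_neq.
rewrite /dirichlet_data opprD addrACA subrr add0r -mulrBr.
have -> : dot (h *: delta_mx 0 i + x) om = h * om 0 i + dot x om.
  rewrite /dot; under eq_bigr do rewrite !mxE eqxx mulrDl.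
  rewrite big_split /=; congr (_ + _); rewrite (bigD1 i)//= big1 => [|k /negbTE ->].
    by rewrite eqxx mulr1 addr0.
  by rewrite mulr0 mul0r.
rewrite addrK mulrCA; apply/esym; exact: mulKf.
Unshelve. all: by end_near. Qed.

Lemma partial_dirichlet_data c om (t : R) i :
  partial i (dirichlet_data c om t) = fun=> t * om 0 i.
Proof.
by apply/funext => x; have [_] := is_derive_dirichlet_data c om t x i.
Qed.

Lemma partials_dirichlet_data c om (t : R) (s : seq 'I_n) i :
  partials (rcons s i) (dirichlet_data c om t) =
  fun=> if s is [::] then t * om 0 i else 0.
Proof.
by rewrite /partials foldr_rcons -/(partials _ _) partial_dirichlet_data partials_cst.
Qed.

Lemma dirichlet_data_continuous c om (t : R) : continuous (dirichlet_data c om t).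
Proof.
have -> : dirichlet_data c om t = fun x => c + t * \sum_k x 0 k * om 0 k by [].
have cs : continuous (fun x : 'rV[R]_n => \sum_k x 0 k * om 0 k).
  apply: continuous_big => [|k _ x]; first exact: add_continuous.
  apply: (@continuousM R _ (fun y : 'rV[R]_n => y 0 k) (fun=> om 0 k)).
    exact: coord_continuous.
  exact: cst_continuous.
move=> x.
apply: (@continuousD _ _ _ (fun=> c) (fun y : 'rV[R]_n => t * \sum_k y 0 k * om 0 k)).
  exact: cst_continuous.
by apply: (@continuousM _ _ (fun=> t)); [exact: cst_continuous|exact: cs].
Qed.

Lemma Ck_closure_dirichlet_data k c om (t : R) :
  Ck_closure D k (dirichlet_data c om t).
Proof.
have cd := @dirichlet_data_continuous c om t.
split.
- exact: continuous_subspaceT.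
- move=> s i x _ _; case/lastP: s => [|s j].
    by have [] := is_derive_dirichlet_data c om t x i.
  by rewrite partials_dirichlet_data; exact: derivable_cst.
- move=> s _; case/lastP: s => [|s j].
    by exists (dirichlet_data c om t) => //; exact: continuous_subspaceT.
  rewrite partials_dirichlet_data; eexists; last by [].
  by apply: continuous_subspaceT; exact: cst_continuous.
Qed.

(** Constants have to be admissible competitors in the uniqueness clause, which ranges over the
    Hölder space. *)
Lemma holder_space_cst k (alpha : R) c : holder_space D k alpha (fun=> c).
Proof.
have E : (fun=> c) = dirichlet_data c (0 : 'rV[R]_n) 0.
  by apply/funext => x; rewrite /dirichlet_data mul0r addr0.
split; first by rewrite E; exact: Ck_closure_dirichlet_data.
have S (T : Type) (A : set T) (F : T -> R) M : (forall y, F y <= M) ->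
    (ereal_sup [set (F y)%:E | y in A] < +oo)%E.
  move=> FM; apply: (@le_lt_trans _ _ M%:E); last exact: ltry.
  by apply: ge_ereal_sup => _ [y _ <-]; rewrite lee_fin.
apply: lte_add_pinfty.
  apply: lte_sum_pinfty => m _; apply: lte_sum_pinfty => s _.
  by rewrite partials_cst; apply: S.
apply: lte_sum_pinfty => s _; apply: (S _ _ _ 0) => p.
by rewrite partials_cst subrr normr0 mul0r.
Qed.

End AffineFunctions.

(** * The equation in nondivergence form *)

Section Equation.
Context {R : realType} {n : nat}.
Variable Omega : set 'rV[R]_n.
Hypothesis Omega_open : open Omega.

Lemma is_solution_cst (alpha : R) (a : R -> 'rV[R]_n -> 'M[R]_n) (c : R) om :
  is_solution alpha Omega a (dirichlet_data c om 0) (fun=> c).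
Proof.
split; [exact: holder_space_cst| |by move=> x _; rewrite /dirichlet_data mul0r addr0].
move=> x _; rewrite big1 ?oppr0// => i _; rewrite big1// => k _.
have -> : (fun y => a c (gradient (fun=> c) y) i k * partial k (fun _ : 'rV[R]_n => c) y) = fun=> 0.
  by apply/funext => y; rewrite partial_cst mulr0.
by rewrite partial_cst.
Qed.

Lemma plim_dir (w : 'rV[R]_n -> R) x v d : is_derive x v w d ->
  plim (F := (0 : R)^') id (fun t : R => w (t *: v + x)) (fun=> w x) (w x) d.
Proof.
move=> dw; split; [|exact: cvg_cst|by move: dw => /is_deriveP].
have [+ _] := dw => /derivable1P/derivable1_diffP/differentiable_continuous.
by move=> /continuous_withinNx; rewrite scale0r add0r.
Qed.

(** Class C^2 on the closure only provides derivatives along the axes, so the chain rule for g(u,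
    grad u) is taken from [plim_comp], with a constant second family: it asks for one-directional
    derivatives of u and grad u and for C^1 regularity of [g]. *)
Lemma solution_nondiv (alpha : R) (a : R -> 'rV[R]_n -> 'M[R]_n)
    (g : R -> 'rV[R]_n -> R) f u x :
  Ck 1 (fun p : R * 'rV[R]_n => g p.1 p.2) ->
  (forall mu eta, a mu eta = (g mu eta)%:M) ->
  is_solution alpha Omega a f u -> Omega x ->
  nondiv (fun p => g p.1 p.2) (u x) (gradient u x) (fun i k => partials [:: i; k] u x) = 0.
Proof.
move=> Cg ag [[[cu du eu] _] eq_u _] Ox.
have := eq_u x Ox => /eqP; rewrite oppr_eq0 => /eqP <-.
rewrite /nondiv; apply: eq_bigr => i _.
pose G (y : 'rV[R]_n) := g (u y) (gradient u y).
rewrite [RHS](bigD1 i)//= [X in _ = _ + X]big1 => [|k ki]; last first.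
  have -> : (fun y => a (u y) (gradient u y) i k * partial k u y) = fun=> 0.
    by apply/funext => y; rewrite ag mxE eq_sym (negbTE ki) mulr0n mul0r.
  by rewrite partial_cst.
have -> : (fun y => a (u y) (gradient u y) i i * partial i u y) =
    (fun y => G y * partial i u y).
  by apply/funext => y; rewrite ag mxE eqxx mulr1n.
pose ei : 'rV[R]_n := delta_mx 0 i.
have dp k : is_derive x ei (partial k u) (partials [:: i; k] u x).
  by apply/derivableP; exact: (du [:: k]).
have dG : is_derive x ei G ('D_(1, 0) (fun p => g p.1 p.2) (u x, gradient u x) * partial i u x +
   \sum_k 'D_(0, delta_mx 0 k) (fun p => g p.1 p.2) (u x, gradient u x) * partials [:: i; k] u x).
  pose h := \row_k partials [:: i; k] u x.
  apply/is_deriveP.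
  rewrite [X in _ --> X](_ : _ =
    'D_(partial i u x, h) (fun p => g p.1 p.2) (u x, gradient u x)); last first.
    rewrite [RHS]jet_derive; last exact: (proj1 Cg).
    rewrite mulrC; congr (_ + _); apply: eq_bigr => k _.
    by rewrite mxE mulrC.
  have pu : plim (F := (0 : R)^') id (fun t : R => u (t *: ei + x)) (fun=> u x)
     (u x) (partial i u x).
    by apply: plim_dir; apply/derivableP; exact: (du [::]).
  have pp k : plim (F := (0 : R)^') id (fun t : R => gradient u (t *: ei + x) 0 k)
      (fun=> gradient u x 0 k) (gradient u x 0 k) (h 0 k).
    have -> : (fun t : R => gradient u (t *: ei + x) 0 k) = fun t => partial k u (t *: ei + x).
      by apply/funext => t; rewrite mxE.
    rewrite !mxE.
    exact: plim_dir.
  by have [_ _] := plim_comp Cg pu pp.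
transitivity ('D_ei (G * partial i u) x + 0); last by [].
have [_ ->] := is_deriveM dG (dp i).
by rewrite addr0 /GRing.scale /= mxE [RHS]addrC [X in _ = X + _]mulrC.
Qed.

End Equation.

(** * Curves of solutions *)

Section SolutionCurves.
Context {R : realType} {n : nat}.
Variable Omega : set 'rV[R]_n.
Hypothesis Omega_domain : bounded_domain Omega.
Variable i0 : 'I_n.
Local Notation jet s f x := (clext Omega (partials s f) x).

Let Omega_open : open Omega. Proof. by case: Omega_domain. Qed.

(* [U k t] is the k-th derivative at [t] of a C^l curve with values in the
   functions of class C^2 of the closure of Omega. *)
Definition C2_curve l (e : R) (U : nat -> R -> 'rV[R]_n -> R) :=
  (forall j t, (j <= l)%N -> - e < t < e -> Ck_closure Omega 2 (U j t)) /\
  forall (s : seq 'I_n) x, (size s <= 2)%N -> closure Omega x ->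
    (forall j (t : R), (j < l)%N -> - e < t < e ->
         is_derive t 1 (fun r => jet s (U j r) x) (jet s (U j.+1 t) x)) /\
    {for 0, continuous (fun r => jet s (U l r) x)}.

Lemma harmonic_eq0 W : Ck_closure Omega 2 W ->
  (forall x, Omega x -> \sum_i partials [:: i; i] W x = 0) ->
  (forall x, boundary Omega x -> W x = 0) ->
  forall x, closure Omega x -> W x = 0.
Proof.
move=> CW hW bW x cx; apply/eqP; rewrite eq_le (harmonic_le0 i0 Omega_domain CW hW bW cx)/=.
(* W + (-2) W is the form of - W to which the linearity lemmas apply. *)
have CW' := Ck_closure_lin Omega_open (-2) CW CW.
suff : W x + -2 * W x <= 0 by lra.
apply: (harmonic_le0 i0 Omega_domain CW' _ _ cx) => y Oy; last by rewrite bW// mulr0 addr0.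
under eq_bigr do rewrite (partials_lin Omega_open (-2) CW CW (isT : (size [:: _; _] <= 2)%N) Oy).
by rewrite big_split /= -mulr_sumr hW// mulr0 addr0.
Qed.

Lemma C2_curve_continuous l e U s x i : 0 < e -> C2_curve l e U -> (i <= l)%N ->
  (size s <= 2)%N -> closure Omega x ->
  {for 0, continuous (fun r => jet s (U i r) x)}.
Proof.
move=> e0 [_ dU] il s2 cx; have [dU1 dU2] := dU s x s2 cx.
move: il; rewrite leq_eqVlt => /predU1P[->//|il].
have e00 : - e < 0 < e by rewrite oppr_lt0 e0.
by have [/derivable1_diffP/differentiable_continuous] := dU1 i 0 il e00.
Qed.

(** Equality on the closure of the t-derivatives of order < i passes to their spatial derivatives,
    so the difference of the jets vanishes to order i in t and its Taylor coefficient is the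
    variation at the rate t^i. *)
Lemma C2_curve_plim l e U V i s x : 0 < e -> C2_curve l e U -> C2_curve l e V ->
  (i <= l)%N ->
  (forall k y, (k < i)%N -> closure Omega y -> U k 0 y = V k 0 y) ->
  (0 < i)%N -> (size s <= 2)%N -> closure Omega x ->
  plim (F := (0 : R)^'+) (fun t => t ^+ i) (fun t => jet s (U 0%N t) x)
    (fun t => jet s (V 0%N t) x) (jet s (U 0%N 0) x)
    ((jet s (U i 0) x - jet s (V i 0) x) / i`!%:R).
Proof.
move=> e0 cU cV il UV i1 s2 cx.
have UVj k : (k < i)%N -> jet s (U k 0) x = jet s (V k 0) x.
  move=> ki; apply: (clext_eq Omega_open) => y Oy; apply: UV => //.
  exact: subset_closure.
have [dU _] := (proj2 cU) s x s2 cx; have [dV _] := (proj2 cV) s x s2 cx.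
split.
- exact: cvg_at_right_filter (C2_curve_continuous e0 cU (leq0n l) s2 cx).
- rewrite UVj//.
  exact: cvg_at_right_filter (C2_curve_continuous e0 cV (leq0n l) s2 cx).
- pose h k t := jet s (U k t) x - jet s (V k t) x.
  change ((t ^- i * h 0%N t) @[t --> 0^'+] --> h i 0 / i`!%:R).
  have h1 k (t : R) : (k < i)%N -> - e < t < e -> is_derive t 1 (h k) (h k.+1 t).
    move=> ki te; have kl := leq_trans ki il.
    exact: (is_deriveB (dU k t kl te) (dV k t kl te)).
  have h2 k : (k < i)%N -> h k 0 = 0 by move=> ki; rewrite /h UVj// subrr.
  have h3 : {for 0, continuous (h i)}.
    have cUi := C2_curve_continuous e0 cU il s2 cx.
    have cVi := C2_curve_continuous e0 cV il s2 cx.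
    exact: (@continuousB R R R (fun t => jet s (U i t) x) (fun t => jet s (V i t) x) 0 cUi cVi).
  by move: h h1 h2 h3 => h h1 h2 h3; exact: (taylor_cvg e0 h1 h2 h3).
Qed.

(** Gives the zero boundary values required by the maximum principle: the common Dirichlet data is
    differentiated in t. *)
Lemma C2_curve_boundary l e U V x : C2_curve l e U -> C2_curve l e V ->
  (forall t, - e < t < e -> U 0%N t x = V 0%N t x) -> closure Omega x ->
  forall i t, (i <= l)%N -> - e < t < e -> U i t x = V i t x.
Proof.
move=> [CU dU] [CV dV] UV cx.
have [dU0 _] := dU [::] x isT cx; have [dV0 _] := dV [::] x isT cx.
elim=> [|i IHi] t il te; first exact: UV.
rewrite -(clext_nil (CU i.+1 t il te) cx) -(clext_nil (CV i.+1 t il te) cx).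
have [_ <-] := dU0 i t il te; have [_ <-] := dV0 i t il te.
apply: near_eq_derive.
have : t \in `]- e, e[ by rewrite in_itv.
move=> /near_in_itvoo; apply: filterS => r; rewrite in_itv /= => re.
rewrite (clext_nil (CU i r (ltnW il) re) cx) (clext_nil (CV i r (ltnW il) re) cx).
exact: IHi (ltnW il) re.
Qed.

Lemma near0_itv (e : R) : 0 < e -> \forall t \near (0 : R)^'+, - e < t < e.
Proof.
move=> e0; near=> t; apply/andP; split; last by near: t; exact: nbhs_right_lt.
by rewrite (@lt_trans _ _ 0)// oppr_lt0.
Unshelve. all: by end_near. Qed.

Lemma jet0 l e U t x : C2_curve l e U -> - e < t < e -> Omega x ->
  [/\ U 0%N t x = jet [::] (U 0%N t) x,
      forall k, gradient (U 0%N t) x 0 k = jet [:: k] (U 0%N t) x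
    & forall i k, partials [:: i; k] (U 0%N t) x = jet [:: i; k] (U 0%N t) x].
Proof.
move=> [CU _] te Ox; have C0 := CU 0%N t (leq0n l) te.
split=> [|k|i k]; last by rewrite (clext_in C0).
  by rewrite (clext_nil C0)//; exact: subset_closure.
by rewrite mxE (clext_in C0).
Qed.

Lemma near_jet0 l e U x : 0 < e -> C2_curve l e U -> Omega x ->
  \forall t \near (0 : R)^'+,
  [/\ U 0%N t x = jet [::] (U 0%N t) x,
      forall k, gradient (U 0%N t) x 0 k = jet [:: k] (U 0%N t) x
    & forall i k, partials [:: i; k] (U 0%N t) x = jet [:: i; k] (U 0%N t) x].
Proof.
by move=> /near0_itv te cU Ox; move: te; apply: filterS => t te; exact: jet0 cU te Ox.
Qed.

(* The terms of [nondiv] that do not involve the Laplacian are quadratic in the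
   jet, so they do not contribute to the first order [i] at which the curves
   may differ: there the difference is harmonic. *)
Lemma C2_curve_eq l e U V i (g : R * 'rV[R]_n -> R) (lam : R) : 0 < e ->
  C2_curve l e U -> C2_curve l e V -> Ck 2 g -> g (lam, 0) != 0 ->
  (0 < i <= l)%N ->
  (forall x, closure Omega x -> U 0%N 0 x = lam) ->
  (forall t x, - e < t < e -> boundary Omega x -> U 0%N t x = V 0%N t x) ->
  (forall k y, (k < i)%N -> closure Omega y -> U k 0 y = V k 0 y) ->
  (forall x, Omega x -> t ^- i *
     (nondiv g (U 0%N t x) (gradient (U 0%N t) x) (fun j k => partials [:: j; k] (U 0%N t) x)
    - nondiv g (V 0%N t x) (gradient (V 0%N t) x) (fun j k => partials [:: j; k] (V 0%N t) x))
     @[t --> 0^'+] --> 0) ->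
  forall x, closure Omega x -> U i 0 x = V i 0 x.
Proof.
move=> e0 cU cV Cg g0 /andP[i1 il] U0 bUV UV eqUV x cx.
have e00 : - e < 0 < e by rewrite oppr_lt0 e0.
have CU := (proj1 cU) i 0 il e00; have CV := (proj1 cV) i 0 il e00.
apply/eqP; rewrite -subr_eq0; apply/eqP.
rewrite -[U i 0 x - V i 0 x]/(U i 0 x + - V i 0 x) -mulN1r.
apply: (harmonic_eq0 (Ck_closure_lin Omega_open (-1) CU CV)) => //; last first.
  move=> y by_; rewrite mulN1r (C2_curve_boundary cU cV _ (proj1 by_) il e00) ?subrr// => t te.
  exact: bUV.
move=> y Oy; have cy := subset_closure Oy.
under eq_bigr do rewrite (partials_lin Omega_open (-1) CU CV (isT : (size [:: _; _] <= 2)%N) Oy) mulN1r.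
have U00 s : jet s (U 0%N 0) y = if s is [::] then lam else 0.
  rewrite (@clext_eq _ _ _ Omega_open _ (fun=> lam)); last first.
    by move=> z Oz; rewrite U0//; exact: subset_closure.
  rewrite partials_cst /clext; apply: cvg_lim; first exact: norm_hausdorff.
  have FF : ProperFilter (within Omega (nbhs y)) by exact: within_nbhs_proper.
  exact: cvg_cst.
pose d s := (jet s (U i 0) y - jet s (V i 0) y) / i`!%:R.
have pl s (s2 : (size s <= 2)%N) : plim (F := (0 : R)^'+) (fun t => t ^+ i)
    (fun t => jet s (U 0%N t) y) (fun t => jet s (V 0%N t) y)
    (if s is [::] then lam else 0) (d s).
  by rewrite -U00; exact: (C2_curve_plim e0 cU cV il UV i1 s2 cy).
have jU := near_jet0 e0 cU Oy.
have jV := near_jet0 e0 cV Oy.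
have pm : plim (F := (0 : R)^'+) (fun t => t ^+ i)
    (fun t => U 0%N t y) (fun t => V 0%N t y) lam (d [::]).
  apply: (plim_near_eq _ _ (pl [::] isT)).
    by move: jU; apply: filterS => t [->].
  by move: jV; apply: filterS => t [->].
have pp k : plim (F := (0 : R)^'+) (fun t => t ^+ i)
    (fun t => gradient (U 0%N t) y 0 k) (fun t => gradient (V 0%N t) y 0 k) 0 (d [:: k]).
  apply: (plim_near_eq _ _ (pl [:: k] isT)).
    by move: jU; apply: filterS => t [_ ->].
  by move: jV; apply: filterS => t [_ ->].
have pH j k : plim (F := (0 : R)^'+) (fun t => t ^+ i)
    (fun t => partials [:: j; k] (U 0%N t) y) (fun t => partials [:: j; k] (V 0%N t) y) 0 (d [:: j; k]).
  apply: (plim_near_eq _ _ (pl [:: j; k] isT)).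
    by move: jU; apply: filterS => t [_ _ ->].
  by move: jV; apply: filterS => t [_ _ ->].
have lim0 := nondiv_plim Cg pm pp pH.
(* The same quotient has two limits: 0 by hypothesis, and g(lam, 0) times the Laplacian of the
   difference divided by i!. *)
have E : g (lam, 0) * \sum_j d [:: j; j] = 0.
  exact: (cvg_unique (@norm_hausdorff _ _) (lim0 _) (eqUV y Oy)).
move/eqP : E; rewrite mulf_eq0 (negbTE g0)/= -mulr_suml mulf_eq0 invr_eq0 pnatr_eq0.
rewrite (gtn_eqF (fact_gt0 i)) orbF => /eqP S0; rewrite -[RHS]S0.
apply: eq_bigr => k _; congr (_ - _); apply/esym.
  exact: (clext_in (s := [:: k; k]) CU isT Oy).
exact: (clext_in (s := [:: k; k]) CV isT Oy).
Unshelve. all: by end_near. Qed.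

Definition affine_curve (lam : R) om (k : nat) (t : R) : 'rV[R]_n -> R :=
  match k with
  | 0%N => dirichlet_data lam om t
  | 1%N => dirichlet_data 0 om 1
  | _ => dirichlet_data 0 om 0
  end.

Lemma affine_curve_C2 l e lam om : C2_curve l e (affine_curve lam om).
Proof.
have CA k t : Ck_closure Omega 2 (affine_curve lam om k t).
  by case: k => [|[|k]]; exact: Ck_closure_dirichlet_data.
split=> [j t _ _|s x s2 cx]; first exact: CA.
have dA j (t : R) : is_derive t 1 (fun r => jet s (affine_curve lam om j r) x)
    (jet s (affine_curve lam om j.+1 t) x).
  have E r : jet s (dirichlet_data lam om r) x =
      jet s (dirichlet_data lam om 0) x + r * jet s (dirichlet_data 0 om 1) x.
    rewrite -(clext_lin Omega_open r (CA 0%N 0) (CA 1%N 0) s2 cx).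
    by apply: (clext_eq Omega_open) => y _; rewrite /affine_curve /dirichlet_data /=; ring.
  have Z : jet s (dirichlet_data 0 om 0) x = 0.
    have := clext_lin Omega_open (-1) (CA 2%N 0) (CA 2%N 0) s2 cx.
    rewrite mulN1r subrr => Z0; rewrite -[RHS]Z0; apply: (clext_eq Omega_open) => y _.
    by rewrite /affine_curve /dirichlet_data /=; ring.
  case: j => [|[|j]] /=; last 2 first.
  - by rewrite Z; exact: is_derive_cst.
  - by rewrite Z; exact: is_derive_cst.
  under eq_fun do rewrite E mulrC.
  exact: is_derive_affine.
split=> [j t _ _|]; first exact: dA.
by have [/derivable1_diffP/differentiable_continuous] := dA l 0.
Qed.

(** * First-order expansion of a curve of solutions *)

Section OneCoefficient.
Variables (alpha e : R) (l : nat).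
Hypotheses (e0 : 0 < e) (l1 : (0 < l)%N).
Variables (a : R -> 'rV[R]_n -> 'M[R]_n) (g : R -> 'rV[R]_n -> R) (lam : R) (om : 'rV[R]_n).
Hypothesis Cg : Ck 2 (fun p : R * 'rV[R]_n => g p.1 p.2).
Hypothesis g0 : forall mu eta, 0 < g mu eta.
Hypothesis ag : forall mu eta, a mu eta = (g mu eta)%:M.
Variable U : nat -> R -> 'rV[R]_n -> R.
Hypothesis cU : C2_curve l e U.
Hypothesis solU : forall t, - e < t < e ->
  is_unique_solution alpha Omega a (dirichlet_data lam om t) (U 0%N t).

(** At t = 0 the constant [lam] solves the problem, and uniqueness identifies it. *)
Lemma solution_curve0 x : closure Omega x -> U 0%N 0 x = lam.
Proof.
move=> cx; have e00 : - e < 0 < e by rewrite oppr_lt0 e0.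
have [_ uniq] := solU e00; apply/esym.
by apply: (uniq (fun=> lam)) => //; exact: is_solution_cst.
Qed.

Lemma solution_curve_nondiv x t : Omega x -> - e < t < e ->
  nondiv (fun p => g p.1 p.2) (U 0%N t x) (gradient (U 0%N t) x)
    (fun j k => partials [:: j; k] (U 0%N t) x) = 0.
Proof.
move=> Ox te; have [sol _] := solU te.
exact: (solution_nondiv (CkW (isT : (1 <= 2)%N) Cg) ag sol Ox).
Qed.

(* [affine_curve_C2] gives a curve with the same boundary values, which solves
   the equation up to [o(t)]: compare with it. *)
Lemma solution_curve1 x : closure Omega x -> U 1%N 0 x = dirichlet_data 0 om 1 x.
Proof.
move=> cx; have cA := affine_curve_C2 l e lam om.
apply: (C2_curve_eq e0 cU cA Cg _ _ solution_curve0 _ _ _ cx).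
- by rewrite gt_eqF.
- exact: l1.
- by move=> t y te by_; have [[_ _ bd] _] := solU te; exact: bd.
- move=> [|//] y _ cy; rewrite solution_curve0// /affine_curve /dirichlet_data.
  by rewrite mul0r addr0.
move=> y Oy.
have t1 (f : R -> R) d : (forall t, f t = t * d) -> plim (F := (0 : R)^'+) (fun t => t ^+ 1) f (fun=> 0) 0 d.
  move=> fE; split; [|exact: cvg_cst|].
    have -> : f = fun t => t * d by apply/funext.
    rewrite -[X in _ --> X](mul0r d).
    by apply: cvgM; [apply: cvg_at_right_filter; exact: cvg_id|exact: cvg_cst].
  apply: (cvg_near_eq (cvg_cst d)); near=> t.
  by rewrite fE subr0 expr1 mulKf// gt_eqF.
have pm : plim (F := (0 : R)^'+) (fun t => t ^+ 1)
    (fun t => affine_curve lam om 0 t y) (fun=> lam) lam (dot y om).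
  have plam : plim (F := (0 : R)^'+) (fun t => t ^+ 1) (fun=> lam) (fun=> lam) lam 0.
    split; [exact: cvg_cst|exact: cvg_cst|].
    by under eq_fun do rewrite subrr mulr0; exact: cvg_cst.
  have := plimD plam (t1 (fun t => t * dot y om) (dot y om) (fun t => erefl)).
  by rewrite add0r !addr0; apply.
have pp k : plim (F := (0 : R)^'+) (fun t => t ^+ 1)
    (fun t => gradient (affine_curve lam om 0 t) y 0 k) (fun=> (0 : 'rV[R]_n) 0 k) 0 (om 0 k).
  by rewrite mxE; apply: t1 => t; rewrite mxE partial_dirichlet_data.
have pH (j k : 'I_n) : plim (F := (0 : R)^'+) (fun t => t ^+ 1)
    (fun t => partials [:: j; k] (affine_curve lam om 0 t) y) (fun=> 0) 0 0.
  by apply: t1 => t; rewrite (partials_dirichlet_data _ _ _ [:: j] k) mulr0.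
(* The affine function is compared with the constant state, on which [nondiv] vanishes: its Hessian
   is zero, so its residual is o(t). *)
have lim0 := nondiv_plim Cg pm pp pH.
have Z : nondiv (fun p => g p.1 p.2) lam (0 : 'rV[R]_n) (fun _ _ => 0) = 0.
  by rewrite /nondiv big1// => j _; rewrite mxE !mulr0 addr0.
have := cvgN (lim0 _); rewrite big1// mulr0 oppr0 => lim1.
apply: (cvg_near_eq (lim1 _ _)).
have := near0_itv e0; apply: filterS => t te.
have E (A B C r : R) : C = 0 -> B = 0 -> - (r * (A - C)) = r * (B - A).
  by move=> -> ->; rewrite subr0 sub0r mulrN.
exact: (E _ _ _ _ Z (solution_curve_nondiv Oy te)).
Unshelve. all: by end_near. Qed.

Lemma clext_cst c x : closure Omega x -> clext Omega (fun=> c) x = c.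
Proof.
move=> cx; have FF : ProperFilter (within Omega (nbhs x)) by exact: within_nbhs_proper.
by apply: cvg_lim; [exact: norm_hausdorff|exact: cvg_cst].
Qed.

(** The expansion in the form used later: gradient equivalent to t [om] and Hessian o(t). It is
    stated up to the boundary, where the flux is read. *)
Lemma solution_curve_jets x : closure Omega x ->
  [/\ jet [::] (U 0%N t) x @[t --> (0 : R)^'+] --> lam,
      t^-1 *: (\row_k jet [:: k] (U 0%N t) x) @[t --> (0 : R)^'+] --> om
    & forall j k, t^-1 * jet [:: j; k] (U 0%N t) x @[t --> (0 : R)^'+] --> 0].
Proof.
move=> cx; have e00 : - e < 0 < e by rewrite oppr_lt0 e0.
have J0 s : jet s (U 0%N 0) x = if s is [::] then lam else 0.
  rewrite (@clext_eq _ _ _ Omega_open _ (fun=> lam)); last first.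
    by move=> z Oz; apply: solution_curve0; exact: subset_closure.
  by rewrite partials_cst clext_cst.
have J1 s : jet s (U 1%N 0) x = jet s (dirichlet_data 0 om 1) x.
  by apply: (clext_eq Omega_open) => z Oz; apply: solution_curve1; exact: subset_closure.
have dJ s d : (size s <= 2)%N -> jet s (dirichlet_data 0 om 1) x = d ->
    t^-1 * (jet s (U 0%N t) x - (if s is [::] then lam else 0)) @[t --> (0 : R)^'+] --> d.
  move=> s2 <-; have [/(_ 0%N 0 l1 e00) + _] := (proj2 cU) s x s2 cx.
  rewrite J1 => /is_deriveP/cvg_dnbhs_at_right dJ.
  apply: (cvg_near_eq dJ); apply: nearW => t.
  by rewrite J0 addr0 [t *: 1]mulr1.
split.
- rewrite -(J0 [::]); apply: cvg_at_right_filter.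
  exact: (C2_curve_continuous (s := [::]) e0 cU (leq0n l) isT cx).
- apply: cvg_rV => k.
  have D1 : jet [:: k] (dirichlet_data 0 om 1) x = om 0 k.
    by rewrite (partials_dirichlet_data 0 om 1 [::] k) mul1r; exact: clext_cst.
  have H := dJ [:: k] _ isT D1.
  apply: (cvg_near_eq H); apply: nearW => t.
  by rewrite subr0 !mxE.
- move=> j k.
  have D1 : jet [:: j; k] (dirichlet_data 0 om 1) x = 0.
    by rewrite (partials_dirichlet_data 0 om 1 [:: j] k); exact: clext_cst.
  have H := dJ [:: j; k] _ isT D1.
  by apply: (cvg_near_eq H); apply: nearW => t; rewrite subr0.
Qed.

End OneCoefficient.

(** * Comparison of the two curves of solutions and of their fluxes *)

Section TwoCoefficients.
Variables (alpha e : R) (l : nat).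
Hypotheses (e0 : 0 < e).
Variables (a1 a2 : R -> 'rV[R]_n -> 'M[R]_n) (g1 g2 : R -> 'rV[R]_n -> R).
Variables (lam : R) (om : 'rV[R]_n).
Let G1 (p : R * 'rV[R]_n) := g1 p.1 p.2.
Let G2 (p : R * 'rV[R]_n) := g2 p.1 p.2.
Let dG p := G1 p + (-1) * G2 p.
Hypotheses (CG1 : Ck (2 + l) G1) (CG2 : Ck (2 + l) G2).
Hypothesis g1_gt0 : forall mu eta, 0 < g1 mu eta.
Hypothesis g2_gt0 : forall mu eta, 0 < g2 mu eta.
Hypothesis ag1 : forall mu eta, a1 mu eta = (g1 mu eta)%:M.
Hypothesis ag2 : forall mu eta, a2 mu eta = (g2 mu eta)%:M.
Variables U V : nat -> R -> 'rV[R]_n -> R.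
Hypotheses (cU : C2_curve l e U) (cV : C2_curve l e V).
Hypothesis solU : forall t, - e < t < e ->
  is_unique_solution alpha Omega a1 (dirichlet_data lam om t) (U 0%N t).
Hypothesis solV : forall t, - e < t < e ->
  is_unique_solution alpha Omega a2 (dirichlet_data lam om t) (V 0%N t).
Variable m : nat.
Hypothesis ml : (m < l)%N.
Hypothesis flat_dG : \forall mu \near lam, flat m dG mu.

Let l1 : (0 < l)%N. Proof. exact: leq_ltn_trans ml. Qed.
Let C2G1 : Ck 2 G1. Proof. by apply: CkW CG1; exact: leq_addr. Qed.
Let C2G2 : Ck 2 G2. Proof. by apply: CkW CG2; exact: leq_addr. Qed.
Let CdG : Ck m.+1 dG.
Proof. by apply: Ck_lin; [apply: CkW CG1|apply: CkW CG2]; rewrite (leq_trans ml)// leq_addl. Qed.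

Lemma nondiv_dG_cvg x : Omega x -> t ^- m.+1 *
  nondiv dG (V 0%N t x) (gradient (V 0%N t) x) (fun j k => partials [:: j; k] (V 0%N t) x)
  @[t --> (0 : R)^'+] --> 0.
Proof.
move=> Ox; have cx := subset_closure Ox.
have [Jm Jp JH] := solution_curve_jets e0 l1 C2G2 g2_gt0 ag2 cV solV cx.
have H := nondiv_flat_cvg CdG flat_dG Jm Jp JH.
apply: (cvg_near_eq H); have := near_jet0 e0 cV Ox; apply: filterS => t [Em Ep EH].
rewrite Em; congr (_ * nondiv _ _ _ _).
  by apply/rowP => k; rewrite [RHS]Ep mxE.
by apply/funext => j; apply/funext => k; rewrite EH.
Qed.

(** Strong induction on the order. The operator of [G1] vanishes along [U], and along [V] it equals
    that of [dG], because [V] solves the other equation; flatness makes this o(t^(m+1)), small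
    enough at every order i <= m+1. *)
Lemma solution_curves_eq i x : (i <= m.+1)%N -> closure Omega x -> U i 0 x = V i 0 x.
Proof.
have [p] := ubnP i; elim: p i x => // p IH i x ip im cx.
have [->|i1] := posnP i.
  rewrite (solution_curve0 e0 solU cx).
  by rewrite (solution_curve0 e0 solV cx).
apply: (C2_curve_eq e0 cU cV C2G1 _ _ (solution_curve0 e0 solU) _ _ _ cx).
- by rewrite gt_eqF// g1_gt0.
- by rewrite i1 (leq_trans im).
- move=> t y te by_; have [[_ _ bU] _] := solU te; have [[_ _ bV] _] := solV te.
  by rewrite bU ?bV.
- move=> k y ki cy; apply: IH => //; first exact: leq_trans ki _.
  exact: leq_trans (ltnW ki) im.
move=> y Oy.
have tp : t ^+ (m.+1 - i) @[t --> (0 : R)^'+] --> (0 : R) ^+ (m.+1 - i).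
  by apply: cvg_at_right_filter; exact: exprn_continuous.
have := cvgN (cvgM tp (nondiv_dG_cvg Oy)); rewrite mulr0 oppr0 => H.
apply: (cvg_near_eq (H _ _)).
have te := near0_itv e0.
near=> t.
have tE : - e < t < e by near: t.
have E (A B C N q r w : R) : A = 0 -> C = 0 -> B - C = N -> q * r = w ->
    - (q * (r * N)) = w * (A - B).
  by move=> -> -> <- <-; rewrite subr0 sub0r mulrN mulrA.
apply: (E _ _ _ _ _ _ _ (solution_curve_nondiv C2G1 ag1 solU Oy tE)
  (solution_curve_nondiv C2G2 ag2 solV Oy tE)).
  exact: (nondiv_sub _ _ _ (CkS C2G1) (CkS C2G2)).
rewrite -[in t ^- m.+1](subnK im) exprD invfM mulrA mulfV ?mul1r//.
by rewrite expf_neq0// gt_eqF.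
Unshelve. all: by end_near. Qed.

Lemma conormal_fluxE nu (a : R -> 'rV[R]_n -> 'M[R]_n) (g : R -> 'rV[R]_n -> R) f x :
  (forall mu eta, a mu eta = (g mu eta)%:M) -> Ck_closure Omega 2 f -> closure Omega x ->
  conormal_flux Omega nu a f x =
  g (jet [::] f x) (\row_k jet [:: k] f x) * \sum_k (\row_k jet [:: k] f x) 0 k * nu x 0 k.
Proof.
move=> ag Cf cx; rewrite /conormal_flux (clext_nil Cf cx) mulr_sumr.
have -> : clgradient Omega f x = \row_k jet [:: k] f x by [].
have agE mu eta i k : a mu eta i k = g mu eta *+ (i == k) by rewrite ag mxE.
apply: eq_bigr => i _; rewrite (bigD1 i)//= big1 => [|k ki].
  by rewrite agE eqxx mulr1n addr0 mulrA.
by rewrite agE eq_sym (negbTE ki) mulr0n !mul0r.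
Qed.

(** As the jets of [U] and [V] agree up to o(t^(m+1)), replacing [U] by [V] in the first flux
    changes it by o(t^(m+1)). Flux equality then makes dG times the normal derivative of [V] an
    o(t^(m+1)), whereas its factors have limits at the rates t^m and t. *)
Lemma flux_step nu x : closure Omega x ->
  (\forall t \near (0 : R)^'+,
    conormal_flux Omega nu a1 (U 0%N t) x = conormal_flux Omega nu a2 (V 0%N t) x) ->
  iderive m (0, om) dG (lam, 0) * dot om (nu x) = 0.
Proof.
move=> cx flux.
pose mU t := jet [::] (U 0%N t) x; pose mV t := jet [::] (V 0%N t) x.
pose pU t := \row_k jet [:: k] (U 0%N t) x; pose pV t := \row_k jet [:: k] (V 0%N t) x.
have pl s (s2 : (size s <= 2)%N) : plim (F := (0 : R)^'+) (fun t => t ^+ m.+1)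
    (fun t => jet s (U 0%N t) x) (fun t => jet s (V 0%N t) x) (if s is [::] then lam else 0) 0.
  have := C2_curve_plim e0 cU cV ml (fun k y km cy => solution_curves_eq (ltnW km) cy) isT s2 cx.
  have -> : jet s (U m.+1 0) x = jet s (V m.+1 0) x.
    apply: (clext_eq Omega_open) => y Oy; apply: solution_curves_eq => //.
    exact: subset_closure.
  have -> : jet s (U 0%N 0) x = if s is [::] then lam else 0.
    rewrite (@clext_eq _ _ _ Omega_open _ (fun=> lam)); last first.
      by move=> z Oz; apply: (solution_curve0 e0 solU); exact: subset_closure.
    by rewrite partials_cst clext_cst.
  by rewrite subrr mul0r.
have pm : plim (F := (0 : R)^'+) (fun t => t ^+ m.+1) mU mV lam 0 := pl [::] isT.
have pp k : plim (F := (0 : R)^'+) (fun t => t ^+ m.+1) (fun t => pU t 0 k)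
    (fun t => pV t 0 k) ((0 : 'rV[R]_n) 0 k) ((0 : 'rV[R]_n) 0 k).
  by rewrite !mxE; apply: (plim_near_eq _ _ (pl [:: k] isT)); apply: nearW => t; rewrite mxE.
have pn k : plim (F := (0 : R)^'+) (fun t => t ^+ m.+1) (fun=> nu x 0 k) (fun=> nu x 0 k) (nu x 0 k) 0.
  split; [exact: cvg_cst|exact: cvg_cst|].
  by under eq_fun do rewrite subrr mulr0; exact: cvg_cst.
have pg := plim_comp (CkS C2G1) pm pp.
have ps := plim_sum (index_enum 'I_n) (fun k => plimM (pp k) (pn k)).
have [_ _ lim0] := plimM (pg _) (ps _ _).
have Z : G1 (lam, 0) *
      (\sum_k ((0 : 'rV[R]_n) 0 k * 0 + (0 : 'rV[R]_n) 0 k * nu x 0 k)) +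
    'D_(0, 0) G1 (lam, 0) * \sum_k (0 : 'rV[R]_n) 0 k * nu x 0 k = 0.
  rewrite big1 => [|k _]; last by rewrite mxE !mul0r addr0.
  by rewrite big1 => [|k _]; [rewrite !mulr0 addr0|rewrite mxE mul0r].
rewrite Z in lim0.
have [Jm Jp _] := solution_curve_jets e0 l1 C2G2 g2_gt0 ag2 cV solV cx.
have limd : t ^- m * dG (mV t, pV t) @[t --> (0 : R)^'+] --> iderive m (0, om) dG (lam, 0) / m`!%:R.
  apply: (flat_cvg (CkS CdG) Jm Jp).
  have flm : \forall t \near (0 : R)^'+, flat m dG (jet [::] (V 0%N t) x).
    exact: (Jm _ flat_dG).
  by move: flm; apply: filterS => t flt k v km; exact: (flat_iderive v flt km).
have lims : t^-1 * \sum_k pV t 0 k * nu x 0 k @[t --> (0 : R)^'+] --> dot om (nu x).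
  have H : \sum_k (t^-1 * pV t 0 k) * nu x 0 k @[t --> (0 : R)^'+] --> dot om (nu x).
    apply: cvg_big => [|k _]; first exact: add_continuous.
    apply: cvgM; last exact: cvg_cst.
    apply: (cvg_near_eq (cvg_comp _ _ Jp (@coord_continuous _ _ _ 0 k om))).
    by apply: nearW => t; rewrite /= mxE.
  apply: (cvg_near_eq H); apply: nearW => t; rewrite mulr_sumr.
  by apply: eq_bigr => k _; rewrite mulrA.
have lim1 := cvgN (cvgM limd lims).
have te := near0_itv e0.
have : - (iderive m (0, om) dG (lam, 0) / m`!%:R * dot om (nu x)) = 0.
  apply: (cvg_unique (@norm_hausdorff R R) (lim1 _ _)).
  rewrite /=.
  apply: (cvg_near_eq lim0); near=> t.
  have tE : - e < t < e by near: t.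
  have GE : G1 (mU t, pU t) * \sum_k pU t 0 k * nu x 0 k =
         G2 (mV t, pV t) * \sum_k pV t 0 k * nu x 0 k.
    rewrite /G1 /G2 -(conormal_fluxE nu ag1 ((proj1 cU) 0%N t (leq0n l) tE) cx).
    rewrite -(conormal_fluxE nu ag2 ((proj1 cV) 0%N t (leq0n l) tE) cx).
    by near: t.
  (* Here [A] is the common flux, [B] and [C] are the values of [G2] and [G1] at the jet of [V], and
     [s] is the normal derivative of [V]. *)
  have E (A B C s q r w : R) : A = B * s -> q * r = w ->
      w * (A - C * s) = - (q * (C + (-1) * B) * (r * s)) by move=> -> <-; ring.
  by apply: E; [exact: GE|rewrite exprSr invfM].
move/eqP; rewrite oppr_eq0 mulf_eq0 mulf_eq0 invr_eq0 pnatr_eq0.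
by rewrite (gtn_eqF (fact_gt0 m)) orbF -mulf_eq0 => /eqP.
Unshelve. all: by end_near. Qed.

End TwoCoefficients.

End SolutionCurves.

(** * Determination of the coefficients *)

Section Conclusion.
Context {R : realType} {n : nat}.
Local Notation E := (R * 'rV[R]_n)%type.

Lemma iderive_scale m (f : E -> R) (c : R) v x : Ck m f ->
  iderive m (c *: v) f x = c ^+ m * iderive m v f x.
Proof.
elim: m f => [f _|m IHm f Cf]; first by rewrite mul1r.
have [df Df] := Cf.
rewrite iderivSr (_ : 'D_(c *: v) f = fun y => 0 + c * 'D_v f y); last first.
  by apply/funext => y; rewrite deriveZdir// add0r.
rewrite (iderive_lin _ c (Ck_cst _ _) (Df v)) (IHm _ (Df v)).
have -> : iderive m (c *: v) (fun=> 0) x = 0.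
  by case: m {IHm Cf Df} => // m; rewrite iderive_cst.
by rewrite add0r -iderivSr exprS mulrA.
Qed.

Lemma eta_derive_lin vs (f g : E -> R) (c : R) : Ck (size vs) f -> Ck (size vs) g ->
  eta_derive vs (fun z => f z + c * g z) =
  (fun z => eta_derive vs f z + c * eta_derive vs g z).
Proof.
elim: vs => // v vs IH Cf Cg; apply/funext => z.
rewrite [LHS](_ : _ = 'D_(0, v) (eta_derive vs (fun z => f z + c * g z)) z)//.
rewrite (IH (CkS Cf) (CkS Cg)).
have [df _] : Ck 1 (eta_derive vs f) by apply: eta_derive_Ck; rewrite addn1.
have [dg _] : Ck 1 (eta_derive vs g) by apply: eta_derive_Ck; rewrite addn1.
by apply: derive_lin; exact: diff_derivable.
Qed.

Lemma derive_scalar_mx (h : 'rV[R]_n -> R) v x : derivable h x v ->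
  'D_v (fun y => (h y)%:M : 'M[R]_n) x = ('D_v h x)%:M.
Proof.
move=> dh.
have Eh (i k : 'I_n) : (fun y => ((h y)%:M : 'M[R]_n) i k) = fun y => h y *+ (i == k).
  by apply/funext => y; rewrite mxE.
have dik (i k : 'I_n) : is_derive x v (fun y => h y *+ (i == k)) ('D_v h x *+ (i == k)).
  case: eqP => _; last exact: is_derive_cst.
  by rewrite mulr1n; under eq_fun do rewrite mulr1n; exact/derivableP.
rewrite derive_mx; last by apply/derivable_mxP => i k; rewrite Eh; have [] := dik i k.
by apply/matrixP => i k; rewrite !mxE Eh; have [_] := dik i k.
Qed.

(** Passage from the matrix-valued derivatives of the conclusion, with [lam] frozen, to scalar
    derivatives on the product space in the directions (0, v). *)
Lemma Dk_scalar_mx (b : R -> 'rV[R]_n -> 'M[R]_n) (g : R -> 'rV[R]_n -> R)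
    (lam : R) (vs : seq 'rV[R]_n) eta :
  (forall mu eta, b mu eta = (g mu eta)%:M) ->
  Ck (size vs) (fun p : E => g p.1 p.2) ->
  foldr (fun v (f : 'rV[R]_n -> 'M[R]_n) => fun y => 'D_v f y) (b lam) vs eta =
  (eta_derive vs (fun p : E => g p.1 p.2) (lam, eta))%:M.
Proof.
move=> bg; elim: vs eta => [eta _|v vs IH eta Cg]; first exact: bg.
have [dg _] : Ck 1 (eta_derive vs (fun p : E => g p.1 p.2)).
  by apply: eta_derive_Ck; rewrite addn1.
rewrite /= -derive_slice_eta -derive_scalar_mx.
  by congr ('D_v _ eta); apply/funext => y; apply: IH; exact: CkS.
apply: (@diff_derivable _ _ _ (fun y => eta_derive vs (fun p : E => g p.1 p.2) (lam, y))).
apply: (@differentiable_comp _ _ _ _ (fun y : 'rV[R]_n => (lam, y))); last exact: dg.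
by apply: differentiable_pair.
Qed.

(** Homogeneity of degree m extends the vanishing from unit vectors to every direction off the
    hyperplane orthogonal to [N]. These directions form a relatively open set, nonempty because it
    contains [N], so polarization reaches all lists of directions. *)
Lemma flat_polarization m (f : E -> R) (lam : R) (N : 'rV[R]_n) : Ck m f ->
  dot N N = 1 -> flat m f lam ->
  (forall om, enorm om = 1 -> iderive m (0, om) f (lam, 0) * dot om N = 0) ->
  flat m.+1 f lam.
Proof.
move=> Cf NN fl Hom vs; rewrite ltnS leq_eqVlt => /predU1P[sz|]; last exact: fl.
pose S := [set v : E | v.1 = 0].
pose U := [set v : E | v.1 = 0 /\ dot v.2 N != 0].
have dotDl (v w : 'rV[R]_n) (t : R) : dot (v + t *: w) N = dot v N + t * dot w N.
  rewrite /dot mulr_sumr -big_split /=; apply: eq_bigr => k _.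
  by rewrite !mxE mulrDl mulrA.
have dotZl (w : 'rV[R]_n) (t : R) : dot (t *: w) N = t * dot w N.
  by rewrite /dot mulr_sumr; apply: eq_bigr => k _; rewrite mxE mulrA.
have -> : eta_derive vs f (lam, 0) =
    foldr (fun v (g : E -> R) => fun y => 'D_v g y) f [seq (0, v) | v <- vs] (lam, 0).
  by rewrite foldr_map.
apply: (@polarization R E S U m f (lam, 0)) => //.
- by exists (0, N); split=> //=; rewrite NN oner_neq0.
- move=> v w [v1 v2] w1.
  have : (dot v.2 N + t * dot w.2 N) @[t --> (0 : R)] --> dot v.2 N.
    have T : (dot v.2 N + t * dot w.2 N) @[t --> (0 : R)] --> dot v.2 N + 0 * dot w.2 N.
      apply: cvgD; first exact: cvg_cst.
      by apply: cvgM; [exact: cvg_id|exact: cvg_cst].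
    by rewrite mul0r addr0 in T.
  move=> /cvgr_neq0; move=> /(_ v2); apply: filterS => t tN.
  by split=> /=; [rewrite v1 w1 scaler0 addr0|rewrite dotDl].
- move=> [v1 w] [/= -> wN].
  have w0 : 0 < dot w w.
    rewrite lt_neqAle; apply/andP; split; last first.
      by rewrite /dot sumr_ge0// => k _; rewrite -expr2 sqr_ge0.
    apply: contra_neq wN => /esym/eqP; rewrite /dot psumr_eq0 => [/allP w0|k _]; last first.
      by rewrite -expr2 sqr_ge0.
    rewrite big1// => k _.
    by have := w0 k (mem_index_enum _); rewrite mulf_eq0 orbb => /eqP ->; rewrite mul0r.
  have ew0 : 0 < enorm w by rewrite /enorm sqrtr_gt0.
  pose om := (enorm w)^-1 *: w.
  have wE : (0, w) = enorm w *: (0, om) :> E.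
    by congr (_, _) => /=; rewrite ?scaler0// scalerA mulfV ?gt_eqF// scale1r.
  have eom : enorm om = 1.
    rewrite /enorm (_ : dot om om = 1) ?sqrtr1//.
    rewrite (_ : dot om om = (enorm w) ^- 2 * dot w w); last first.
      rewrite /dot mulr_sumr; apply: eq_bigr => k _.
      by rewrite !mxE expr2 invfM; ring.
    by rewrite /enorm sqr_sqrtr ?ltW// mulVf// gt_eqF.
  rewrite wE iderive_scale//; have /eqP := Hom om eom.
  rewrite mulf_eq0 dotZl mulf_eq0 (negbTE wN) orbF invr_eq0 (gt_eqF ew0) orbF => /eqP ->.
  by rewrite mulr0.
- by rewrite size_map.
- by move=> v /mapP[w _ ->].
Qed.

(** Solutions are total functions determined only on the closure; the flux must not see the rest. *)
Lemma conormal_flux_eq (Omega : set 'rV[R]_n) nu a f g x : open Omega ->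
  (forall y, closure Omega y -> f y = g y) -> closure Omega x ->
  conormal_flux Omega nu a f x = conormal_flux Omega nu a g x.
Proof.
move=> opO fg cx; rewrite /conormal_flux (fg x cx).
suff -> : clgradient Omega f x = clgradient Omega g x by [].
apply/rowP => k; rewrite !mxE; apply: (@clext_eq _ _ _ opO f g [:: k] x) => y Oy.
by apply: fg; exact: subset_closure.
Qed.

Lemma continuous_eq0_cc (h : R -> R) (r : R) : 0 < r -> continuous h ->
  (forall t, - r < t < r -> h t = 0) -> forall t, - r <= t <= r -> h t = 0.
Proof.
move=> r0 ch h0 t /andP[rt tr].
have tt : (1 - s) * t @[s --> (0 : R)^'+] --> t.
  have T : (1 - s) * t @[s --> (0 : R)] --> (1 - 0) * t.
    by apply: cvgM; [apply: cvgB; [exact: cvg_cst|exact: cvg_id]|exact: cvg_cst].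
  by rewrite subr0 mul1r in T; exact: cvg_at_right_filter T.
have lim1 := cvg_comp _ _ tt (ch t).
apply/esym; apply: (cvg_unique (@norm_hausdorff R R) _ lim1).
apply: (cvg_near_eq (cvg_cst 0)); near=> s => /=.
have s0 : 0 < s by [].
have s1 : s < 1 by near: s; exact: nbhs_right_lt.
by rewrite h0//; apply/andP; split; nra.
Unshelve. all: by end_near. Qed.

End Conclusion.

Theorem corollary2p2 (R : realType) (n : nat) (n_ge2 : (2 <= n)%N)
  (alpha : R) (alpha01 : 0 < alpha < 1)
  (Omega : set 'rV[R]_n) (Omega_domain : bounded_domain Omega)
  (Omega_smooth : holder_boundary 2 alpha Omega)
  (nu : 'rV[R]_n -> 'rV[R]_n)
  (nu_normal : forall x, boundary Omega x -> outward_unit_normal Omega x (nu x))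
  (l : nat) (l_ge1 : (1 <= l)%N)
  (a : 'I_2 -> R -> 'rV[R]_n -> 'M[R]_n)
  (a_smooth : forall j, Ck (2 + l) (fun p : R * 'rV[R]_n => a j p.1 p.2))
  (a_sym : forall j, symmetric_coef (a j))
  (a_ell : forall j, elliptic_coef (a j))
  (gamma : 'I_2 -> R -> 'rV[R]_n -> R)
  (gamma_smooth : forall j, Ck (2 + l) (fun p : R * 'rV[R]_n => gamma j p.1 p.2))
  (gamma_gt0 : forall j mu eta, 0 < gamma j mu eta)
  (a_gamma : forall j mu eta, a j mu eta = (gamma j mu eta)%:M)
  (normals_basis : exists (e' x : 'I_n -> 'rV[R]_n),
     [/\ orthonormal_basis e',
         forall k, boundary Omega (x k)
       & forall k, enorm (nu (x k) - e' k) < 1 / Num.sqrt n%:R])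
  (Rad : R) (Rad_gt0 : 0 < Rad)
  (eps : R -> R)
  (eps_adm : forall lambda, admissible_radius l alpha Omega a lambda (eps lambda))
  (u : 'I_2 -> R -> 'rV[R]_n -> R -> 'rV[R]_n -> R)
  (u_sol : forall j lambda omega tau,
     - Rad <= lambda <= Rad -> enorm omega = 1 ->
     - eps lambda < tau < eps lambda ->
     is_unique_solution alpha Omega (a j) (dirichlet_data lambda omega tau)
       (u j lambda omega tau))
  (x0 : 'rV[R]_n) (x0_bd : boundary Omega x0)
  (epsilon : R -> R)
  (epsilon_lt : forall lambda, - Rad <= lambda <= Rad ->
     0 < epsilon lambda < eps lambda)
  (same_flux : forall lambda omega tau,
     - Rad <= lambda <= Rad -> enorm omega = 1 ->
     - epsilon lambda < tau < epsilon lambda ->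
     conormal_flux Omega nu (a 0) (u 0 lambda omega tau) x0 =
     conormal_flux Omega nu (a 1) (u 1 lambda omega tau) x0) :
  forall lambda (k : nat), - Rad <= lambda <= Rad -> (k <= l.-1)%N ->
    forall vs : k.-tuple 'rV[R]_n,
      Dk (a 0 lambda) 0 vs = Dk (a 1 lambda) 0 vs.
Proof.
have i0 : 'I_n := Ordinal (ltnW n_ge2).
have [[y0 Oy0] opO _ _] := Omega_domain.
have cx0 : closure Omega x0 by have [] := x0_bd.
have NN : dot (nu x0) (nu x0) = 1.
  have [en _ _] := nu_normal x0 x0_bd.
  have d0 : 0 <= dot (nu x0) (nu x0).
    by rewrite /dot sumr_ge0// => k _; rewrite -expr2 sqr_ge0.
  by rewrite -(sqr_sqrtr d0) -/(enorm _) en expr1n.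
(* A nonempty open set contains a second point along the axis [i0], so the Hölder quotients range
   over a nonempty set. *)
have D2 : exists x y, [/\ Omega x, Omega y & x != y].
  have nO : \forall t \near (0 : R)^'+, Omega (y0 + t *: delta_mx 0 i0).
    by have := near_line opO (delta_mx 0 i0) Oy0; exact: cvg_at_right_filter.
  have /filter_ex[t [Ot t0]] : \forall t \near (0 : R)^'+,
      Omega (y0 + t *: delta_mx 0 i0) /\ 0 < t.
    by near=> t; split; [near: t|].
  exists y0, (y0 + t *: delta_mx 0 i0); split=> //.
  rewrite -subr_eq0 opprD addNKr oppr_eq0 scaler_eq0 negb_or gt_eqF//=.
  apply/eqP => /matrixP/(_ 0 i0); rewrite !mxE !eqxx => /eqP.
  by rewrite oner_eq0.
pose G j (p : R * 'rV[R]_n) := gamma j p.1 p.2.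
pose dG p := G 0 p + (-1) * G 1 p.
have CdG k : (k <= 2 + l)%N -> Ck k dG.
  by move=> kl; apply: Ck_lin; exact: CkW kl (gamma_smooth _).
(* The induction hypothesis covers the whole open interval, since [flux_step] needs flatness at all
   [mu] near lambda; at the end points it would give only a one-sided neighbourhood. *)
have step m : (m <= l)%N -> forall lambda, - Rad < lambda < Rad -> flat m dG lambda.
  elim: m => [//|m IHm] ml lambda lamR.
  have flm := IHm (ltnW ml) lambda lamR.
  have lamRad : - Rad <= lambda <= Rad by have /andP[/ltW -> /ltW ->] := lamR.
  apply: (flat_polarization (N := nu x0) _ NN flm).
    by apply: CdG; rewrite (leq_trans (ltnW ml))// leq_addl.
  move=> om eom.
  have [e0 adm] := eps_adm lambda.
  have C2 j : exists U, C2_curve Omega l (eps lambda) U /\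
      forall t, - eps lambda < t < eps lambda ->
      is_unique_solution alpha Omega (a j) (dirichlet_data lambda om t) (U 0%N t).
    have [uj [solj curvj]] := adm j om eom.
    have [U [U0 CU dU]] := holder_curve_derivatives opO D2 e0 curvj.
    by exists U; rewrite U0.
  have [U [cU solU]] := C2 0; have [V [cV solV]] := C2 1.
  have flnear : \forall mu \near lambda, flat m dG mu.
    have : lambda \in `]- Rad, Rad[ by rewrite in_itv.
    by move=> /near_in_itvoo; apply: filterS => mu; rewrite in_itv /=; exact: IHm (ltnW ml) mu.
  apply: (flux_step Omega_domain i0 e0 (gamma_smooth 0) (gamma_smooth 1) (gamma_gt0 0)
    (gamma_gt0 1) (a_gamma 0) (a_gamma 1) cU cV solU solV ml flnear cx0).
  have [ep0 epe] := andP (epsilon_lt lambda lamRad).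
  have := near0_itv ep0; apply: filterS => t tep.
  have te : - eps lambda < t < eps lambda.
    have /andP[t1 t2] := tep; apply/andP; split; last exact: lt_trans t2 epe.
    by apply: lt_trans t1; rewrite ltrN2.
  (* Nothing is assumed on how the given solutions depend on tau; uniqueness identifies them on the
     closure with the C^l curves, so the flux equality transfers to the latter. *)
  have eqf j W : is_unique_solution alpha Omega (a j) (dirichlet_data lambda om t) W ->
      conormal_flux Omega nu (a j) W x0 = conormal_flux Omega nu (a j) (u j lambda om t) x0.
    move=> [solW _]; have [_ uniq] := u_sol j lambda om t lamRad eom te.
    by apply: conormal_flux_eq => // y; exact: uniq.
  by rewrite (eqf 0 _ (solU t te)) (eqf 1 _ (solV t te)) same_flux.
move=> lambda k lamR kl vs.
have kl' : (k < l)%N by rewrite (leq_ltn_trans kl)// ltn_predL.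
have kl2 : (size vs <= 2 + l)%N by rewrite size_tuple (leq_trans (ltnW kl'))// leq_addl.
(* Order k needs flatness of order k+1 <= l in the interior; continuity in [mu] then covers lambda =
   Rad and lambda = - Rad. *)
have z : eta_derive vs dG (lambda, 0) = 0.
  apply: (@continuous_eq0_cc R (fun mu => eta_derive vs dG (mu, 0)) Rad Rad_gt0 _ _ _ lamR).
    move=> mu; have cE : continuous (eta_derive vs dG).
      by apply: (@eta_derive_Ck _ _ _ 0); rewrite addn0; exact: CdG.
    have T : (nu', 0 : 'rV[R]_n) @[nu' --> mu] --> (mu, 0 : 'rV[R]_n).
      by apply: cvg_jet; [exact: cvg_id|exact: cvg_cst].
    exact: (cvg_comp _ _ T (cE (mu, 0))).
  by move=> mu muR; apply: (step k.+1) => //; rewrite size_tuple.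
rewrite /Dk.
rewrite (Dk_scalar_mx lambda 0 (a_gamma 0) (CkW kl2 (gamma_smooth 0))).
rewrite (Dk_scalar_mx lambda 0 (a_gamma 1) (CkW kl2 (gamma_smooth 1))).
congr (_%:M); apply/eqP; rewrite -subr_eq0 -z /dG eta_derive_lin; first by rewrite mulN1r.
  exact: CkW kl2 (gamma_smooth 0).
exact: CkW kl2 (gamma_smooth 1).
Unshelve. all: by end_near. Qed.
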